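(* Let $R$ be a Noetherian integral domain, let $X=\{x_0,\ldots,x_m\}$, $Y=\{y_0,\ldots,y_n\}$ and $Z=\{z_0,\ldots,z_p\}$ be three (disjoint) sets of indeterminates over $R$, and define the polynomials $$f=\sum_{i=0}^m x_it^i,\qquad g=\sum_{j=0}^n y_jt^j,\qquad h=\sum_{k=0}^p z_kt^k.$$ Then, as ideals of $S=R[X,Y,Z]$, the primary decomposition of $c(fgh)$ is given by $$c(fgh)=c(f)\cap c(g)\cap c(h)\cap L(f,g)\cap L(f,h)\cap L(g,h)\cap L(f,g,h),$$ where $$\begin{aligned} L(f,g)&=c(fg)+c(f)^{n+1}+c(g)^{m+1},\\ L(f,h)&=c(fh)+c(f)^{p+1}+c(h)^{m+1},\\ L(g,h)&=c(gh)+c(g)^{p+1}+c(h)^{n+1},\\ L(f,g,h)&=c(fgh)+c(fg)^{p+1}+c(fh)^{n+1}+c(gh)^{m+1}+c(f)^{n+p+1}+c(g)^{m+p+1}+c(h)^{m+n+1}. \end{aligned}$$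
   Context: For a polynomial $F\in S[t]$ with coefficients in a commutative ring $S$, the content $c(F)$ is the ideal of $S$ generated by the coefficients of $F$. *)

(* Defs.v *)
(* Ideals are Prop-valued sets, since ideal membership is not decidable over an
   arbitrary domain. *)
From mathcomp Require Export all_boot all_order all_algebra.
From mathcomp Require Export boolp classical_sets.
From mathcomp Require Export mpoly.

Set Implicit Arguments.
Unset Strict Implicit.
Unset Printing Implicit Defensive.

Import GRing.Theory.
Local Open Scope classical_set_scope.
Local Open Scope ring_scope.

Declare Scope ideal_scope.
Delimit Scope ideal_scope with ID.

Section Ideals.
Variable S : comNzRingType.
Implicit Types (I J Q : set S).

(* The unit ideal is allowed, unlike in ring_quotient's idealr_closed. *)
Definition is_ideal I : Prop :=
  [/\ I 0, forall a b, I a -> I b -> I (a + b) & forall r a, I a -> I (r * a)].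

Definition ideal_gen (A : set S) : set S := smallest is_ideal A.

Definition ideal_add I J : set S := [set a + b | a in I & b in J].

Definition ideal_mul I J : set S := ideal_gen [set a * b | a in I & b in J].

(* The zeroth power is the unit ideal. *)
Definition ideal_pow I (k : nat) : set S := iter k (ideal_mul I) setT.

Definition primary_ideal Q : Prop :=
  [/\ is_ideal Q, ~ Q 1 &
      forall a b, Q (a * b) -> Q a \/ exists k : nat, Q (b ^+ k)].

(* Not required to be irredundant: components may contain one another. *)
Definition primary_decomposition I (Qs : seq (set S)) : Prop :=
  (forall Q, Q \in Qs -> primary_ideal Q) /\
  I = \big[setI/setT]_(Q <- Qs) Q.

Definition noetherian : Prop :=
  forall I, is_ideal I -> exists s : seq S, I = ideal_gen [set` s].

Definition content (F : {poly S}) : set S := ideal_gen [set` polyseq F].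

End Ideals.

Arguments noetherian S : clear implicits.
Arguments content {S} F%_R.

Notation "I + J" := (ideal_add I%ID J%ID) : ideal_scope.
Notation "I ^ k" := (ideal_pow I%ID k%N) : ideal_scope.

(* Main.v *)
Require Import Defs.
From mathcomp Require Import ring zify.

(* Grade S by the degrees a, b, c in the x's, y's and z's.  All ideals involved
   are homogeneous, and the Dedekind-Mertens lemma c(F)^(deg G + 1) c(G) <= c(F G)
   yields the equality of ideals degree by degree.

   Since L(f, g) and L(f, g, h) contain powers of the variables that generate
   their radicals, they are primary once the quotients are torsion-free over the
   polynomials K in the remaining variables.  The key fact is that, for fixed
   d = a - b with -m <= d <= n, the polynomials with this difference of degrees
   form a free module over K[T_0, ..., T_(m+n)], where T_k acts as the k-th
   coefficient of f g.  Indeed, modulo T_0 = x_0 y_0, this module is an extension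
   of the one for ((f - x_0) / t, g, d) by the one for (f, (g - y_0) / t, d - 1).
   In this range S / L(f, g) is therefore free over K, and L(f, g, h) is the
   extension of L(F, h), where F is the sum of the T_k t^k; flatness then reduces
   torsion-freeness for L(f, g, h) to the case of two polynomials.  If none of
   a - b, a - c, b - c lies in its range, then one of a, b, c is so large that
   L(f, g, h) contains everything of that degree. *)

Set Implicit Arguments.
Unset Strict Implicit.
Unset Printing Implicit Defensive.

Import GRing.Theory.
Local Open Scope classical_set_scope.
Local Open Scope ring_scope.

(** * Bihomogeneous polynomials and the Dedekind-Mertens lemma *)

(** Every exponent is a Dedekind-Mertens exponent, that is, a number of coefficients. Since [g h]
    has n + p + 1 of them, c(f)^(n+p+1) c(g h) <= c(f g h): in x-degree at least n + p + 1
    membership in c(g h) suffices, while in lower x-degree c(f)^(n+p+1) has no component at all.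
    Likewise c(f g)^(p+1) c(h) <= c(f g h), so the components of c(f g)^(p+1) of positive z-degree
    lie in c(f g h), and those of z-degree 0 are excluded by intersecting with c(h).

    The obstacle is freeness. Its recursion passes to shorter polynomials, which would change the
    ring, the T_k and the module at every step. Instead S and [Lam], the ring of the T_k, stay
    fixed, and only the pair (i, j) of starting indices of the two tails moves, together with an
    evaluation [ev i j] of [Lam] in S. What has to be known of the variables is reduced to being
    nonzero and to the existence of endomorphisms that send one of them to 0. *)

Section Bihomogeneous.
Variable A : comNzRingType.
Implicit Types (C X Y : set A) (u v : A).

(** The coefficient set [C] need not be a subring; closure properties are asked for lemma by lemma.
    No independence of [X] and [Y] is built in, so the same predicate serves for forms in S, for
    forms in the T_k, and, with [C := setT], for powers of contents. *)
Inductive bihom C X Y : nat -> nat -> A -> Prop :=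
| bihomC c : C c -> bihom C X Y 0 0 c
| bihom0 a b : bihom C X Y a b 0
| bihomD a b u v :
    bihom C X Y a b u -> bihom C X Y a b v -> bihom C X Y a b (u + v)
| bihomMX x a b u : X x -> bihom C X Y a b u -> bihom C X Y a.+1 b (x * u)
| bihomMY y a b u : Y y -> bihom C X Y a b u -> bihom C X Y a b.+1 (y * u).

Lemma bihomC_inv C X Y u : C 0 -> (forall a b, C a -> C b -> C (a + b)) ->
  bihom C X Y 0 0 u -> C u.
Proof.
move=> C0 CD; suff H a b : bihom C X Y a b u -> a = 0%N -> b = 0%N -> C u.
  by move=> /H; apply.
elim=> {a b u} [c Cc|a b|a b v w _ IHv _ IHw|x a b w _ _ _|y a b w _ _ _] // ea eb.
by apply: CD; [apply: IHv | apply: IHw].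
Qed.

Lemma bihom_swap C X Y a b u : bihom C X Y a b u -> bihom C Y X b a u.
Proof.
elim=> {a b u} [c Cc|a b|a b u v _ IHu _ IHv|x a b u xX _ IH|y a b u yY _ IH].
- exact: bihomC.
- exact: bihom0.
- exact: bihomD.
- exact: bihomMY.
- exact: bihomMX.
Qed.

Lemma sub_bihom C X X' Y Y' a b u : X `<=` X' -> Y `<=` Y' ->
  bihom C X Y a b u -> bihom C X' Y' a b u.
Proof.
move=> sX sY.
elim=> {a b u} [c Cc|a b|a b u v _ IHu _ IHv|x a b u xX _ IH|y a b u yY _ IH].
- exact: bihomC.
- exact: bihom0.
- exact: bihomD.
- by apply: bihomMX => //; apply: sX.
- by apply: bihomMY => //; apply: sY.
Qed.

Lemma bihom_free C X X' Y b u : bihom C X Y 0 b u -> bihom C X' Y 0 b u.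
Proof.
suff H a : bihom C X Y a b u -> a = 0%N -> bihom C X' Y a b u by move=> /H; apply.
elim=> {a b u} [c Cc|a b|a b u v _ IHu _ IHv|x a b u xX _ _|y a b u yY _ IH] // ea.
- exact: bihomC.
- exact: bihom0.
- by apply: bihomD; [apply: IHu|apply: IHv].
- by apply: bihomMY => //; apply: IH.
Qed.

Lemma bihom_sum C X Y a b (I : Type) (r : seq I) (P : pred I) (F : I -> A) :
  (forall i, P i -> bihom C X Y a b (F i)) ->
  bihom C X Y a b (\sum_(i <- r | P i) F i).
Proof.
by move=> HF; apply: big_rec => [|i u Pi Hu]; [exact: bihom0|apply: bihomD; auto].
Qed.

Lemma bihomM C X Y a b a' b' u v : (forall c d, C c -> C d -> C (c * d)) ->
  bihom C X Y a b u -> bihom C X Y a' b' v ->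
  bihom C X Y (a + a') (b + b') (u * v).
Proof.
move=> CM Hu Hv.
elim: Hu => {a b u} [c Cc|a b|a b u w _ IHu _ IHw|x a b u xX _ IH|y a b u yY _ IH].
- elim: Hv => {a' b' v} [d Cd|a b|a b u w _ IHu _ IHw|x a b u xX _ IH|y a b u yY _ IH].
  + by apply: bihomC; apply: CM.
  + by rewrite mulr0; apply: bihom0.
  + by rewrite mulrDr; apply: bihomD.
  + by rewrite mulrCA; apply: bihomMX.
  + by rewrite mulrCA; apply: bihomMY.
- by rewrite mul0r; apply: bihom0.
- by rewrite mulrDl; apply: bihomD.
- by rewrite -mulrA; apply: bihomMX.
- by rewrite -mulrA; apply: bihomMY.
Qed.

Lemma bihomN C X Y a b u : (forall c, C c -> C (- c)) ->
  bihom C X Y a b u -> bihom C X Y a b (- u).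
Proof.
move=> CN.
elim=> {a b u} [c Cc|a b|a b u v _ IHu _ IHv|x a b u xX _ IH|y a b u yY _ IH].
- by apply: bihomC; apply: CN.
- by rewrite oppr0; apply: bihom0.
- by rewrite opprD; apply: bihomD.
- by rewrite -mulrN; apply: bihomMX.
- by rewrite -mulrN; apply: bihomMY.
Qed.

Lemma bihomX_empty C X Y a b u : (forall x, ~ X x) -> (0 < a)%N ->
  bihom C X Y a b u -> u = 0.
Proof.
move=> X0 a0 H; elim: H a0 => // {a b u} [a b u v _ IHu _ IHv a0|x a b u xX|y a b u _ _ IH a0].
- by rewrite IHu ?IHv ?addr0.
- by case: (X0 x).
- by rewrite IH ?mulr0.
Qed.

Lemma bihomY_empty C X Y a b u : (forall y, ~ Y y) -> (0 < b)%N ->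
  bihom C X Y a b u -> u = 0.
Proof. by move=> Y0 b0 /bihom_swap; apply: bihomX_empty. Qed.

End Bihomogeneous.

Section Products.
Variable A : comNzRingType.
Implicit Types (x y : nat -> A).

Definition tail x (M i : nat) : set A :=
  [set z | exists2 a, (i <= a < M)%N & z = x a].

(* The k-th coefficient of the product of the tails
   x_i t^i + ... + x_(M-1) t^(M-1) and y_j t^j + ... + y_(N-1) t^(N-1). *)
Definition pcoef x y (M N i j k : nat) : A :=
  \sum_(i <= a < M) \sum_(j <= b < N | (a + b)%N == k) x a * y b.

Lemma pcoef_swap x y M N i j k : pcoef x y M N i j k = pcoef y x N M j i k.
Proof.
rewrite /pcoef.
under eq_bigr do rewrite big_mkcond.
under [RHS]eq_bigr do rewrite big_mkcond.
rewrite exchange_big_nat; apply: eq_bigr => b _; apply: eq_bigr => a _.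
by rewrite addnC mulrC.
Qed.

Lemma pcoef_recl x y M N i j k : (i < M)%N ->
  pcoef x y M N i j k =
  pcoef x y M N i.+1 j k + x i * \sum_(j <= b < N | (i + b)%N == k) y b.
Proof. by move=> iM; rewrite /pcoef big_ltn // addrC mulr_sumr. Qed.

Lemma pcoef_recr x y M N i j k : (j < N)%N ->
  pcoef x y M N i j k =
  pcoef x y M N i j.+1 k + y j * \sum_(i <= a < M | (j + a)%N == k) x a.
Proof. by move=> jN; rewrite pcoef_swap pcoef_recl // pcoef_swap. Qed.

Lemma pcoef_small x y M N i j k : (k < i + j)%N -> pcoef x y M N i j k = 0.
Proof.
move=> kij; rewrite /pcoef big_nat big1 // => a /andP[ia _].
rewrite big_nat_cond big1 // => b /andP[/andP[jb _] /eqP e]; lia.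
Qed.

Lemma pcoef_corner x y M N i j : (i < M)%N -> (j < N)%N ->
  pcoef x y M N i j (i + j) = x i * y j.
Proof.
move=> iM jN; rewrite pcoef_recl // pcoef_small; last by lia.
rewrite add0r big_ltn_cond // eqxx big_nat_cond big1 ?addr0 // => b.
by move=> /andP[/andP[jb _] /eqP e]; lia.
Qed.

Lemma tailS x M i : tail x M i.+1 `<=` tail x M i.
Proof. by move=> z [a Ha ->]; exists a => //; lia. Qed.

Lemma tail_empty x M i z : (M <= i)%N -> ~ tail x M i z.
Proof. by move=> Mi [a Ha _]; lia. Qed.

Variable C : set A.
Hypotheses (C1 : C 1) (CM : forall a b, C a -> C b -> C (a * b)).
Hypothesis CN : forall a, C a -> C (- a).

Definition bih x y M N i j := bihom C (tail x M i) (tail y N j).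

Lemma bih_swap x y M N i j a b u :
  bih x y M N i j a b u -> bih y x N M j i b a u.
Proof. exact: bihom_swap. Qed.

Lemma bihSl x y M N i j a b u :
  bih x y M N i.+1 j a b u -> bih x y M N i j a b u.
Proof. by apply: sub_bihom => //; apply: tailS. Qed.

Lemma bihSr x y M N i j a b u :
  bih x y M N i j.+1 a b u -> bih x y M N i j a b u.
Proof. by apply: sub_bihom => //; apply: tailS. Qed.

(** The terms are sorted by whether they contain [x i]. This is the recursive step both for
    Dedekind-Mertens and for freeness. *)
Lemma bih_splitl x y M N i j a b u : (i < M)%N -> bih x y M N i j a.+1 b u ->
  exists2 v, bih x y M N i.+1 j a.+1 b v &
  exists2 w, bih x y M N i j a b w & u = v + x i * w.
Proof.
move=> iM H; remember a.+1 as a' eqn:ea; elim: H a ea => // {a' b u} [a' b|a' b u v _ IHu _ IHv|z a' b u [k kk ->] Hu IH|z a' b u zY _ IH] a ea.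
- by exists 0; [exact: bihom0|exists 0; [exact: bihom0|rewrite mulr0 addr0]].
- have [v1 Hv1 [w1 Hw1 ->]] := IHu _ ea.
  have [v2 Hv2 [w2 Hw2 ->]] := IHv _ ea.
  exists (v1 + v2); first exact: bihomD.
  by exists (w1 + w2); [exact: bihomD|ring].
- have [<-|ki] := eqVneq i k.
    case: ea => <-; exists 0; first exact: bihom0.
    by exists u => //; rewrite add0r.
  have kt : tail x M i.+1 (x k) by exists k => //; lia.
  case: ea => ea; case: a ea => [|a] ea.
    rewrite ea in Hu *; exists (x k * u); last first.
      by exists 0; [exact: bihom0|rewrite mulr0 addr0].
    by apply: bihomMX => //; apply: bihom_free Hu.
  have [v Hv [w Hw ->]] := IH _ ea.
  exists (x k * v); first exact: bihomMX.
  exists (x k * w); first by apply: bihomMX => //; exact: tailS kt.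
  ring.
- have [v Hv [w Hw ->]] := IH _ ea.
  exists (z * v); first exact: bihomMY.
  exists (z * w); first exact: bihomMY.
  ring.
Qed.

Lemma bih_splitr x y M N i j a b u : (j < N)%N -> bih x y M N i j a b.+1 u ->
  exists2 v, bih x y M N i j.+1 a b.+1 v &
  exists2 w, bih x y M N i j a b w & u = v + y j * w.
Proof.
move=> jN /bih_swap /bih_splitl-/(_ jN)[v Hv [w Hw ->]].
by exists v; [exact: bih_swap|exists w => //; exact: bih_swap].
Qed.

Lemma bih_var_l x y M N i j k : (i <= k < M)%N -> bih x y M N i j 1 0 (x k).
Proof.
by move=> Hk; rewrite -[x k]mulr1; apply: bihomMX; [exists k|apply: bihomC].
Qed.

Lemma bih_var_r x y M N i j k : (j <= k < N)%N -> bih x y M N i j 0 1 (y k).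
Proof. by move=> Hk; apply: bih_swap; apply: bih_var_l. Qed.

(** The part of the ideal of the product's coefficients whose multipliers have bidegree (a, b). The
    summation bound overshoots the last coefficient, of index M + N - 2; the surplus [pcoef]
    vanish. *)
Definition pspan x y M N i j a b u := exists2 v : nat -> A,
  (forall k, bih x y M N i j a b (v k)) &
  u = \sum_(0 <= k < M + N) pcoef x y M N i j k * v k.

Lemma pspan0 x y M N i j a b : pspan x y M N i j a b 0.
Proof.
exists (fun=> 0) => [k|]; first exact: bihom0.
by rewrite big1 // => k _; rewrite mulr0.
Qed.

Lemma pspanD x y M N i j a b u v : pspan x y M N i j a b u ->
  pspan x y M N i j a b v -> pspan x y M N i j a b (u + v).
Proof.
move=> [w Hw ->] [w' Hw' ->]; exists (fun k => w k + w' k).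
  by move=> k; apply: bihomD; [exact: Hw|exact: Hw'].
by rewrite -big_split; apply: eq_bigr => k _; rewrite mulrDr.
Qed.

Lemma pspan_corner x y M N i j a b u : (i < M)%N -> (j < N)%N ->
  bih x y M N i j a b u -> pspan x y M N i j a b (x i * y j * u).
Proof.
move=> iM jN Hu; exists (fun k => if k == (i + j)%N then u else 0).
  by move=> k; case: ifP => // _; apply: bihom0.
rewrite (big_cat_nat (n := (i + j)%N)) //=; last by lia.
rewrite [X in X + _]big_nat [X in X + _]big1; last first.
  by move=> k Hk; rewrite ifF ?mulr0 //; lia.
rewrite add0r big_ltn ?eqxx; last by lia.
rewrite pcoef_corner // big_nat big1 ?addr0 // => k Hk.
by rewrite ifF ?mulr0 //; lia.
Qed.

(* Degreewise form of c(f)^N c(g) <= c(f g).  Splitting off x_i and then y_j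
   reduces to shorter tails, up to multiples of x_i y_j, which is itself the
   lowest coefficient of the product of the two tails. *)
Lemma Dedekind_Mertens x y M N i j a b u : (N - j <= a)%N ->
  bih x y M N i j a b.+1 u -> pspan x y M N i j a.-1 b u.
Proof.
have [n] := ubnP ((M - i) + (N - j))%N.
elim: n i j a u => // n IH i j a u ltn Hja Hu.
case: (leqP N j) => [Nj|jN].
  rewrite (bihomY_empty _ _ Hu) //; first exact: pspan0.
  by move=> z; apply: tail_empty.
case: a Hja Hu => [|a] Hja Hu; first by lia.
case: (leqP M i) => [Mi|iM].
  rewrite (bihomX_empty _ _ Hu) //; first exact: pspan0.
  by move=> z; apply: tail_empty.
have [u2 Hu2 [u1 Hu1 ->]] := bih_splitl iM Hu.
have [||v Hv ->] := IH i.+1 j a.+1 u2 _ _ Hu2; [lia|lia|rewrite /= in Hv *].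
have [v1 Hv1 [v2 Hv2 ->]] := bih_splitr jN Hu1.
set Yk := fun k => \sum_(j <= b < N | (i + b)%N == k) y b.
set Xk := fun k => \sum_(i <= a < M | (j + a)%N == k) x a.
have HYk k : bih x y M N i j 0 1 (Yk k).
  rewrite /Yk big_nat_cond; apply: bihom_sum => l /andP[Hl _].
  exact: bih_var_r.
have HXk k : bih x y M N i j 1 0 (Xk k).
  rewrite /Xk big_nat_cond; apply: bihom_sum => l /andP[Hl _].
  exact: bih_var_l.
(* Restoring [x i] in the shorter product changes the k-th coefficient by [x i * Yk k]; the total
   error is [x i] times a form [s] that can be split again along [y j]. *)
have -> : \sum_(0 <= k < M + N) pcoef x y M N i.+1 j k * v k =
    \sum_(0 <= k < M + N) pcoef x y M N i j k * v k
    - x i * \sum_(0 <= k < M + N) Yk k * v k.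
  rewrite mulr_sumr -sumrB; apply: eq_bigr => k _.
  by rewrite (pcoef_recl _ _ _ _ _ iM) -/(Yk k); ring.
set s := \sum_(0 <= k < M + N) Yk k * v k.
have Hs : bih x y M N i j a b.+1 s.
  apply: bihom_sum => k _; rewrite -[a]add0n -[b.+1]add1n.
  by apply: bihomM; [exact: CM|exact: HYk|apply: bihSl; exact: Hv].
have [s1 Hs1 [s2 Hs2 es]] := bih_splitr jN Hs.
have Hvs : pspan x y M N i j a b (\sum_(0 <= k < M + N) pcoef x y M N i j k * v k).
  by exists v => // k; apply: bihSl; exact: Hv.
(* Shortening the y-tail lowers the required x-degree by one, which pays for the factor [x i]
   already removed. If no x-degree is left, the y-tail from [j.+1] is empty and [t = 0]. *)
have Hx t : bih x y M N i j.+1 a b.+1 t -> pspan x y M N i j a b (x i * t).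
  move=> Ht; case: a Hja {Hu Hu2 Hu1 Hv Hv1 Hv2 Hs Hs1 Hs2 Hvs} Ht => [|a] Hja Ht.
    rewrite (bihomY_empty _ _ Ht) ?mulr0 //; first exact: pspan0.
    by move=> z; apply: tail_empty; lia.
  have [||w Hw ->] := IH i j.+1 a.+1 t _ _ Ht; [lia|lia|rewrite /= in Hw *].
  have -> : x i * (\sum_(0 <= k < M + N) pcoef x y M N i j.+1 k * w k) =
      \sum_(0 <= k < M + N) pcoef x y M N i j k * (x i * w k)
      + x i * y j * (- \sum_(0 <= k < M + N) Xk k * w k).
    rewrite mulr_sumr mulrN mulr_sumr -sumrB; apply: eq_bigr => k _.
    by rewrite (pcoef_recr _ _ _ _ _ jN) -/(Xk k); ring.
  apply: pspanD.
    exists (fun k => x i * w k) => // k; apply: bihomMX; last by apply: bihSr; exact: Hw.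
    by exists i => //; lia.
  apply: pspan_corner => //; apply: bihomN; first exact: CN.
  apply: bihom_sum => k _; rewrite -[a.+1]add1n -[b]add0n.
  by apply: bihomM; [exact: CM|exact: HXk|apply: bihSr; exact: Hw].
have -> : \sum_(0 <= k < M + N) pcoef x y M N i j k * v k - x i * s
    + x i * (v1 + y j * v2) =
  \sum_(0 <= k < M + N) pcoef x y M N i j k * v k + x i * (v1 - s1)
    + x i * y j * (v2 - s2) by rewrite es; ring.
apply: pspanD; first apply: pspanD => //.
  by apply: Hx; apply: bihomD => //; apply: bihomN.
by apply: pspan_corner => //; apply: bihomD => //; apply: bihomN.
Qed.

End Products.

(** * Freeness over the coefficients of the product *)

(* S plays the role of K[x_0, ..., x_(M-1), y_0, ..., y_(N-1)] with K = range e0,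
   Lam that of K[tau_0, tau_1, ...], and ev i j sends tau_k to the k-th
   coefficient of the product of the tails starting at x_i and y_j. *)
Record generic_pair (S : idomainType) (Lam : comNzRingType) (x y : nat -> S)
    (M N : nat) (kap : {rmorphism S -> Lam}) (e0 : {rmorphism S -> S})
    (tau : nat -> Lam) (ev : nat -> nat -> {rmorphism Lam -> S}) : Prop :=
  GenericPair {
    ev_kap : forall i j s, ev i j (kap s) = e0 s;
    kap_e0 : forall s, kap (e0 s) = kap s;
    ev_tau : forall i j k, (k < M + N)%N ->
      ev i j (tau k) = pcoef x y M N i j k;
    gp_x_neq0 : forall i, (i < M)%N -> x i != 0;
    gp_y_neq0 : forall j, (j < N)%N -> y j != 0;
    gp_kill_x : forall i, (i < M)%N -> exists e : {rmorphism S -> S},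
      [/\ forall s, e (e0 s) = e0 s, e (x i) = 0,
          forall k, (k < M)%N -> k != i -> e (x k) = x k &
          forall j, (j < N)%N -> e (y j) = y j];
    gp_kill_y : forall j, (j < N)%N -> exists e : {rmorphism S -> S},
      [/\ forall s, e (e0 s) = e0 s, e (y j) = 0,
          forall k, (k < N)%N -> k != j -> e (y k) = y k &
          forall i, (i < M)%N -> e (x i) = x i] }.

Lemma generic_pair_swap S Lam x y M N kap e0 tau ev :
  @generic_pair S Lam x y M N kap e0 tau ev ->
  @generic_pair S Lam y x N M kap e0 tau (fun i j => ev j i).
Proof.
case=> H1 H2 H3 H4 H5 H6 H7; split=> // i j k Hk.
by rewrite pcoef_swap H3 // addnC.
Qed.

Section RangeClosed.
Variables (S T : comNzRingType) (h : {rmorphism S -> T}).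

Lemma range0 : range h 0.
Proof. by exists 0 => //; rewrite rmorph0. Qed.

Lemma range1 : range h 1.
Proof. by exists 1 => //; rewrite rmorph1. Qed.

Lemma rangeD a b : range h a -> range h b -> range h (a + b).
Proof. by move=> [s _ <-] [t _ <-]; exists (s + t) => //; rewrite rmorphD. Qed.

Lemma rangeM a b : range h a -> range h b -> range h (a * b).
Proof. by move=> [s _ <-] [t _ <-]; exists (s * t) => //; rewrite rmorphM. Qed.

Lemma rangeN a : range h a -> range h (- a).
Proof. by move=> [s _ <-]; exists (- s) => //; rewrite rmorphN. Qed.

End RangeClosed.

Section Freeness.
Variables (S : idomainType) (Lam : comNzRingType).

Section Basis.
Variables (x y : nat -> S) (M N : nat) (kap : {rmorphism S -> Lam}).
Variables (e0 : {rmorphism S -> S}) (tau : nat -> Lam).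
Variable ev : nat -> nat -> {rmorphism Lam -> S}.

Definition bihS := bih (range e0) x y M N.

(** Forms of degree e in [tau k, ..., tau (M + N - 2)] over K; the second family is an empty tail,
    so the lemmas on [bih] apply. The start k matters because [ev i j] sends [tau l] to 0 for l < i
    + j: for the tails at (i, j), freeness can only hold over the later ones. *)
Definition homL (k e : nat) (w : Lam) : Prop :=
  bih (range kap) tau (fun=> 0) (M + N).-1 0 k 0 e 0 w.

(** For b < c the truncated [b - c] would be 0 and admit constants, whereas such a coordinate has to
    vanish. *)
Definition coordL (k b c : nat) (w : Lam) : Prop :=
  if (c <= b)%N then homL k (b - c) w else w = 0.

Definition spanned i j (I : finType) (bd : I -> nat) (be : I -> S) b u :=
  exists2 w : I -> Lam, (forall l, coordL (i + j) b (bd l) (w l)) &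
    u = \sum_l ev i j (w l) * be l.

(* The bihomogeneous pieces of bidegree (a, b) with a + s = b + t together
   form a free Lam-module with basis be, where the coordinates of an element of
   bidegree (a, b) are homogeneous of degree b - bd l. *)
Definition free_basis i j s t (I : finType) (ad bd : I -> nat) (be : I -> S) :=
  [/\ forall l, (ad l + s = bd l + t)%N,
      forall l, bihS i j (ad l) (bd l) (be l),
      forall a b u, (a + s = b + t)%N -> bihS i j a b u ->
        spanned i j bd be b u &
      forall b w, (forall l, coordL (i + j) b (bd l) (w l)) ->
        \sum_l ev i j (w l) * be l = 0 -> forall l, w l = 0].

Hypothesis gp : generic_pair x y M N kap e0 tau ev.

Lemma bihSM i j a b a' b' u v :
  bihS i j a b u -> bihS i j a' b' v -> bihS i j (a + a') (b + b') (u * v).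
Proof. by apply: bihomM; apply: rangeM. Qed.

Lemma bihSN i j a b u : bihS i j a b u -> bihS i j a b (- u).
Proof. by apply: bihomN; apply: rangeN. Qed.

Lemma bihS_pcoef i j k : bihS i j 1 1 (pcoef x y M N i j k).
Proof.
rewrite /pcoef big_nat; apply: bihom_sum => a Ha.
rewrite big_nat_cond; apply: bihom_sum => b /andP[Hb _].
by apply: (@bihSM i j 1 0 0 1); [apply: bih_var_l|apply: bih_var_r] => //; apply: range1.
Qed.

Lemma homL0 k e : homL k e 0. Proof. exact: bihom0. Qed.

Lemma homLD k e u v : homL k e u -> homL k e v -> homL k e (u + v).
Proof. exact: bihomD. Qed.

Lemma homLM k e e' u v : homL k e u -> homL k e' v -> homL k (e + e') (u * v).
Proof. by apply: (@bihomM _ _ _ _ e 0 e' 0); apply: rangeM. Qed.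

Lemma homLN k e u : homL k e u -> homL k e (- u).
Proof. by apply: bihomN; apply: rangeN. Qed.

Lemma homL_tau k l : (k <= l < (M + N).-1)%N -> homL k 1 (tau l).
Proof. by move=> Hl; apply: bih_var_l => //; apply: range1. Qed.

Lemma homL_kap k s : homL k 0 (kap s).
Proof. by apply: bihomC; exists s. Qed.

Lemma homLW k e w : homL k.+1 e w -> homL k e w.
Proof. exact: bihSl. Qed.

Lemma homL_ind (P : nat -> Lam -> Prop) k :
  (forall s, P 0%N (kap s)) -> (forall e, P e 0) ->
  (forall e u v, P e u -> P e v -> P e (u + v)) ->
  (forall e l u, (k <= l < (M + N).-1)%N -> homL k e u -> P e u ->
     P e.+1 (tau l * u)) ->
  forall e u, homL k e u -> P e u.
Proof.
move=> Pk P0 PD Pt e u; rewrite /homL /bih.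
suff H b : bihom (range kap) (tail tau (M + N).-1 k) (tail (fun=> 0) 0 0) e b u ->
    b = 0%N -> P e u by move=> /H; apply.
elim=> {e b u} [c [s _ <-]|a b|a b u v _ IHu _ IHv|z a b u [l Hl ->] Hu IH|z a b u _ _ _] // ea.
- by apply: PD; auto.
- by apply: Pt; auto; move: Hu; rewrite ea.
Qed.

Lemma coordL0 k b c : coordL k b c 0.
Proof. by rewrite /coordL; case: ifP => // _; apply: homL0. Qed.

Lemma coordLD k b c u v : coordL k b c u -> coordL k b c v -> coordL k b c (u + v).
Proof.
by rewrite /coordL; case: ifP => _; [apply: homLD|move=> -> ->; rewrite addr0].
Qed.

Lemma coordLN k b c u : coordL k b c u -> coordL k b c (- u).
Proof.
by rewrite /coordL; case: ifP => _; [apply: homLN|move=> ->; rewrite oppr0].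
Qed.

Lemma coordLM k b c e u v : homL k e u -> coordL k b c v ->
  coordL k (e + b) c (u * v).
Proof.
rewrite /coordL => Hu; case: ifP => cb Hv.
  by rewrite ifT; [rewrite -addnBA //; apply: homLM|lia].
by rewrite Hv mulr0; case: ifP => // _; apply: homL0.
Qed.

Lemma coordLW k b c w : coordL k.+1 b c w -> coordL k b c w.
Proof. by rewrite /coordL; case: ifP => // _; apply: homLW. Qed.

Lemma spanned0 i j I bd be b : @spanned i j I bd be b 0.
Proof.
exists (fun=> 0) => [l|]; first exact: coordL0.
by rewrite big1 // => l _; rewrite rmorph0 mul0r.
Qed.

Lemma spannedD i j I bd be b u v : @spanned i j I bd be b u ->
  spanned i j bd be b v -> spanned i j bd be b (u + v).
Proof.
move=> [w Hw ->] [w' Hw' ->]; exists (fun l => w l + w' l).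
  by move=> l; apply: coordLD; [apply: Hw|apply: Hw'].
by rewrite -big_split; apply: eq_bigr => l _; rewrite rmorphD mulrDl.
Qed.

Lemma spannedM i j I bd be b e v u : homL (i + j) e v -> @spanned i j I bd be b u ->
  spanned i j bd be (e + b) (ev i j v * u).
Proof.
move=> Hv [w Hw ->]; exists (fun l => v * w l).
  by move=> l; apply: coordLM.
by rewrite mulr_sumr; apply: eq_bigr => l _; rewrite rmorphM mulrA.
Qed.

Lemma bihS_ev k i j e w : homL k e w -> bihS i j e e (ev i j w).
Proof.
apply: (homL_ind (P := fun e w => bihS i j e e (ev i j w))) => {e w} [s|e|e u v Hu Hv|e l u Hl _ Hu].
- by rewrite (ev_kap gp); apply: bihomC; exists s.
- by rewrite rmorph0; apply: bihom0.
- by rewrite rmorphD; apply: bihomD.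
- rewrite rmorphM (ev_tau gp); last by lia.
  by apply: (@bihSM i j 1 1 e e) => //; apply: bihS_pcoef.
Qed.

(** Each [pcoef] changes by a multiple of [x i] when the x-tail is shortened, and this passes to
    products. On constants the two evaluations agree, hence the case distinction on e. *)
Lemma ev_diff_l k i j e w : (i < M)%N -> homL k e w ->
  exists2 v, (if e is e'.+1 then bihS i j e' e v else v = 0) &
    ev i.+1 j w = ev i j w + x i * v.
Proof.
move=> iM; apply: (homL_ind (P := fun e w => exists2 v,
    (if e is e'.+1 then bihS i j e' e v else v = 0) &
    ev i.+1 j w = ev i j w + x i * v)) => {e w} [s|e|e u v|e l u Hl Hu].
- by exists 0 => //; rewrite !(ev_kap gp) mulr0 addr0.
- by exists 0; [case: e => // e; apply: bihom0|rewrite !rmorph0 mulr0 addr0].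
- move=> [u1 Hu1 eu] [v1 Hv1 ev1]; exists (u1 + v1).
    case: e Hu1 Hv1 => [-> ->|e]; first by rewrite addr0.
    exact: bihomD.
  by rewrite !rmorphD eu ev1; ring.
- move=> [u1 Hu1 eu].
  set Yk := \sum_(j <= b < N | (i + b)%N == l) y b.
  have HYk : bihS i j 0 1 Yk.
    rewrite /Yk big_nat_cond; apply: bihom_sum => b /andP[Hb _].
    by apply: bih_var_r => //; apply: range1.
  have Hu1' : bihS i j e e.+1 (pcoef x y M N i j l * u1).
    case: e {Hu eu} Hu1 => [->|e Hu1]; first by rewrite mulr0; apply: bihom0.
    by apply: (@bihSM i j 1 1 e e.+1) => //; apply: bihS_pcoef.
  exists (pcoef x y M N i j l * u1 - Yk * ev i.+1 j u).
    apply: bihomD => //; apply: bihSN.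
    apply: (@bihSM i j 0 1 e e) => //.
    by apply: bihSl; apply: bihS_ev Hu.
  rewrite !rmorphM !(ev_tau gp) ; try lia.
  have e1 := pcoef_recl x y N j l iM; rewrite -/Yk in e1.
  by rewrite eu e1; ring.
Qed.

Lemma coordL_split k b c w : (k < (M + N).-1)%N -> coordL k b c w ->
  exists w01 : Lam * Lam, [/\ coordL k.+1 b c w01.1,
     if b is b'.+1 then coordL k b' c w01.2 else w01.2 = 0 &
     w = w01.1 + tau k * w01.2].
Proof.
rewrite /coordL => kM; case: ifP => cb; last first.
  move=> ->; exists (0, 0); split=> //; last by rewrite mulr0 addr0.
  by case: b cb => // b cb; rewrite ifF //=; lia.
case eb: (b - c)%N => [|d] Hw.
  exists (w, 0); split=> //=; last by rewrite mulr0 addr0.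
    exact: bihom_free Hw.
  by case: b cb eb => // b cb eb; case: ifP => // _; apply: homL0.
have [w0 Hw0 [w1 Hw1 ->]] := bih_splitl kM Hw.
exists (w0, w1); split=> //=.
case: b cb eb => [|b] cb eb; first by lia.
by rewrite ifT; [have -> : (b - c = d)%N by lia|lia].
Qed.

(** Turns a relation between forms at (i, j) into one at (i + 1, j) by reduction modulo [x i]. *)
Lemma kill_ev_l i j k e w (h : {rmorphism S -> S}) : (i < M)%N ->
  (forall s, h (e0 s) = e0 s) -> h (x i) = 0 ->
  (forall k, (k < M)%N -> k != i -> h (x k) = x k) ->
  (forall j, (j < N)%N -> h (y j) = y j) ->
  homL k e w -> h (ev i j w) = ev i.+1 j w.
Proof.
move=> iM h0 hxi hx hy.
apply: (homL_ind (P := fun e w => h (ev i j w) = ev i.+1 j w)) => {e w} [s|e|e u v Hu Hv|e l u Hl _ Hu].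
- by rewrite !(ev_kap gp) h0.
- by rewrite !rmorph0.
- by rewrite !rmorphD Hu Hv.
- rewrite !rmorphM Hu !(ev_tau gp); try lia.
  rewrite (pcoef_recl _ _ _ _ _ iM) rmorphD rmorphM hxi mul0r addr0; congr (_ * _).
  rewrite /pcoef rmorph_sum big_nat [RHS]big_nat; apply: eq_bigr => a Ha.
  rewrite rmorph_sum big_nat_cond [RHS]big_nat_cond; apply: eq_bigr => b /andP[Hb _].
  by rewrite rmorphM hx ?hy //; lia.
Qed.

Lemma kill_bihS_l i j a b u (h : {rmorphism S -> S}) :
  (forall s, h (e0 s) = e0 s) ->
  (forall k, (k < M)%N -> k != i -> h (x k) = x k) ->
  (forall j, (j < N)%N -> h (y j) = y j) ->
  bihS i.+1 j a b u -> h u = u.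
Proof.
move=> h0 hx hy.
elim=> {a b u} [c [s _ <-]|a b|a b u v _ IHu _ IHv|z a b u [k Hk ->] _ IH|z a b u [k Hk ->] _ IH].
- exact: h0.
- exact: rmorph0.
- by rewrite rmorphD IHu IHv.
- by rewrite rmorphM hx ?IH //; lia.
- by rewrite rmorphM hy ?IH //; lia.
Qed.

End Basis.

Section Step.
Variables (x y : nat -> S) (M N : nat) (kap : {rmorphism S -> Lam}).
Variables (e0 : {rmorphism S -> S}) (tau : nat -> Lam).
Variable ev : nat -> nat -> {rmorphism Lam -> S}.
Hypothesis gp : generic_pair x y M N kap e0 tau ev.
Variables i j : nat.
Hypotheses (iM : (i < M)%N) (jN : (j < N)%N).

Local Notation bihS := (bihS x y M N e0).
Local Notation homL := (homL M N kap tau).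
Local Notation coordL := (coordL M N kap tau).
Local Notation spanned := (spanned M N kap tau ev).

Let gps := generic_pair_swap gp.

Lemma ev_diff_r k e w : homL k e w ->
  exists2 v, (if e is e'.+1 then bihS i j e e' v else v = 0) &
    ev i j.+1 w = ev i j w + y j * v.
Proof.
rewrite /homL addnC => Hw.
have [v Hv Ev] := ev_diff_l gps i jN Hw.
by exists v => //; case: e {Hw Ev} Hv => // e; apply: bih_swap.
Qed.

Lemma corner_homL : homL (i + j) 1 (tau (i + j)).
Proof. by apply: homL_tau; lia. Qed.

Lemma ev_corner : ev i j (tau (i + j)) = x i * y j.
Proof. by rewrite (ev_tau gp); [rewrite pcoef_corner|lia]. Qed.

Variables (s t : nat) (I J : finType).
Variables (adI bdI : I -> nat) (beI : I -> S) (adJ bdJ : J -> nat) (beJ : J -> S).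
Hypothesis HI : free_basis x y M N kap e0 tau ev i j.+1 s.+1 t adI bdI beI.
Hypothesis HJ : free_basis x y M N kap e0 tau ev i.+1 j s t adJ bdJ beJ.

(** Basis elements from [HI] are multiplied by [x i], which raises their x-degree and explains
    [s.+1] there; those from [HJ] represent the quotient by the multiples of [x i]. *)
Let ad (l : I + J) := match l with inl l => (adI l).+1 | inr l => adJ l end.
Let bd (l : I + J) := match l with inl l => bdI l | inr l => bdJ l end.
Let be (l : I + J) := match l with inl l => x i * beI l | inr l => beJ l end.

(** The expansion of [u] in the basis [beJ] uses [ev i.+1 j]; replacing it by [ev i j] produces
    errors divisible by [x i], which [v] collects. *)
Lemma bih_splitJ a b u : (a + s = b + t)%N -> bihS i.+1 j a b u ->
  exists2 v, (if a is a'.+1 then bihS i j a' b v else v = 0) &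
    spanned i j bd be b (u - x i * v).
Proof.
case: HJ => sJ bJ gJ _ ab Hu; have [w Hw ->] := gJ _ _ _ ab Hu.
have /choice[v Hv] : forall l, exists v,
    (if a is a'.+1 then bihS i j a' b v else v = 0) /\
    ev i.+1 j (w l) * beJ l = ev i j (w l) * beJ l + x i * v.
  move=> l; have := Hw l; rewrite /coordL; case: ifP => bl; last first.
    move=> ->; exists 0; split; first by case: a {Hu ab} => // a; apply: bihom0.
    by rewrite !rmorph0; ring.
  move=> Hwl; have [v Hv Ev] := ev_diff_l gp j iM Hwl.
  exists (v * beJ l); split; last by rewrite Ev; ring.
  have sl := sJ l; have bl' := bihSl (bJ l).
  case ee : (b - bdJ l)%N Hv => [|e] Hv.
    by rewrite Hv mul0r; case: a {Hu ab} => // a; apply: bihom0.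
  case: a ab {Hu} => [|a] ab; first by lia.
  have -> : a = (e + adJ l)%N by lia.
  by have -> : b = (e.+1 + bdJ l)%N by [lia|]; apply: bihSM.
exists (\sum_l v l).
  case: a {Hu ab} Hv => [|a] Hv; first by rewrite big1 // => l _; case: (Hv l).
  by apply: bihom_sum => l _; case: (Hv l).
exists (fun l => match l with inl _ => 0 | inr l => w l end).
  case=> l /=; first exact: coordL0.
  by apply: coordLW; have := Hw l; rewrite addSn.
rewrite big_sumType /= [X in _ = X + _]big1; last first.
  by move=> l _; rewrite rmorph0 mul0r.
rewrite add0r mulr_sumr -sumrB; apply: eq_bigr => l _.
by case: (Hv l) => _ ->; rewrite addrK.
Qed.

(** Here the errors are divisible by [y j]. Once multiplied by [x i] they become multiples of
    [x i * y j], the value of [tau (i + j)]. *)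
Lemma bih_splitI a b u : (a + s.+1 = b + t)%N -> bihS i j.+1 a b u ->
  exists2 v, (if b is b'.+1 then bihS i j a b' v else v = 0) &
    spanned i j bd be b (x i * (u - y j * v)).
Proof.
case: HI => sI bI gI _ ab Hu; have [w Hw ->] := gI _ _ _ ab Hu.
have /choice[v Hv] : forall l, exists v,
    (if b is b'.+1 then bihS i j a b' v else v = 0) /\
    ev i j.+1 (w l) * beI l = ev i j (w l) * beI l + y j * v.
  move=> l; have := Hw l; rewrite /coordL; case: ifP => bl; last first.
    move=> ->; exists 0; split; first by case: b {Hu ab Hw bl} => // b; apply: bihom0.
    by rewrite !rmorph0; ring.
  move=> Hwl; have [v Hv Ev] := ev_diff_r Hwl.
  exists (v * beI l); split; last by rewrite Ev; ring.
  have sl := sI l; have bl' := bihSr (bI l).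
  case ee : (b - bdI l)%N Hv => [|e] Hv.
    by rewrite Hv mul0r; case: b {Hu ab Hw bl Hwl ee} => // b; apply: bihom0.
  case: b ab {Hu Hw Hwl} bl ee => [|b] ab bl ee; first by lia.
  have -> : a = (e.+1 + adI l)%N by lia.
  by have -> : b = (e + bdI l)%N by [lia|]; apply: bihSM.
exists (\sum_l v l).
  case: b {Hu ab Hw} Hv => [|b] Hv; first by rewrite big1 // => l _; case: (Hv l).
  by apply: bihom_sum => l _; case: (Hv l).
exists (fun l => match l with inl l => w l | inr _ => 0 end).
  case=> l /=; last exact: coordL0.
  by apply: coordLW; have := Hw l; rewrite addnS.
rewrite big_sumType /= [X in _ = _ + X]big1; last first.
  by move=> l _; rewrite rmorph0 mul0r.
rewrite addr0 mulr_sumr -sumrB mulr_sumr; apply: eq_bigr => l _.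
by case: (Hv l) => _ ->; rewrite addrK mulrCA.
Qed.

(** A division algorithm: [bih_splitJ] removes the part without [x i], and [bih_splitI] removes the
    part of the cofactor without [y j]. What remains is [ev i j (tau (i + j))] times a form whose
    two degrees are one lower, so induction on b applies. *)
Lemma step_span a b u : (a + s = b + t)%N -> bihS i j a b u ->
  spanned i j bd be b u.
Proof.
elim: b a u => [|b IH] a u ab Hu.
- have [v Hv [w Hw ->]] : exists2 v, bihS i.+1 j a 0 v &
      exists2 w, (if a is a'.+1 then bihS i j a' 0 w else w = 0) & u = v + x i * w.
    case: a {ab} Hu => [|a] Hu; last exact: bih_splitl.
    by exists u; [exact: bihom_free Hu|exists 0 => //; rewrite mulr0 addr0].
  have [v1 Hv1 Sv1] := bih_splitJ ab Hv.
  rewrite -[v](subrK (x i * v1)) -addrA; apply: spannedD => //.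
  case: a ab {Hu Hv} Hw Hv1 => [|a] ab Hw Hv1.
    by rewrite Hw Hv1 mulr0 addr0; apply: spanned0.
  rewrite -mulrDr.
  have Hwv : bihS i j.+1 a 0 (v1 + w).
    by apply: bih_swap; apply: bihom_free; apply: bih_swap; apply: bihomD Hv1 Hw.
  have ab' : (a + s.+1 = 0 + t)%N by lia.
  have [v2 -> Sv2] := bih_splitI ab' Hwv.
  by rewrite mulr0 subr0 in Sv2.
- have [v Hv [w Hw ->]] : exists2 v, bihS i.+1 j a b.+1 v &
      exists2 w, (if a is a'.+1 then bihS i j a' b.+1 w else w = 0) & u = v + x i * w.
    case: a {ab} Hu => [|a] Hu; last exact: bih_splitl.
    by exists u; [exact: bihom_free Hu|exists 0 => //; rewrite mulr0 addr0].
  have [v1 Hv1 Sv1] := bih_splitJ ab Hv.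
  rewrite -[v](subrK (x i * v1)) -addrA; apply: spannedD => //.
  case: a ab {Hu Hv} Hw Hv1 => [|a] ab Hw Hv1.
    by rewrite Hw Hv1 mulr0 addr0; apply: spanned0.
  rewrite -mulrDr.
  have Hwv : bihS i j a b.+1 (v1 + w) by apply: bihomD.
  have [z1 Hz1 [z2 Hz2 ->]] := bih_splitr jN Hwv.
  have ab' : (a + s.+1 = b.+1 + t)%N by lia.
  have [v2 Hv2 Sv2] := bih_splitI ab' Hz1.
  have -> : x i * (z1 + y j * z2) =
      x i * (z1 - y j * v2) + ev i j (tau (i + j)) * (v2 + z2).
    by rewrite ev_corner; ring.
  apply: spannedD => //; rewrite -add1n; apply: spannedM; first exact: corner_homL.
  by apply: (IH a); [lia|apply: bihomD].
Qed.

(** Modulo [x i] only the terms of [J] survive, and [HJ] makes their [w0] vanish. After cancelling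
    [x i], reduction modulo [y j] leaves only the terms of [I], where [HI] applies. The remaining
    common factor [x i * y j] cancels since S is a domain. *)
Lemma step_indep1 b (w0 w1 : I + J -> Lam) :
  (forall l, coordL (i + j).+1 b (bd l) (w0 l)) ->
  (forall l, exists e, homL (i + j) e (w1 l)) ->
  \sum_l ev i j (w0 l + tau (i + j) * w1 l) * be l = 0 ->
  (forall l, w0 l = 0) /\ \sum_l ev i j (w1 l) * be l = 0.
Proof.
case: HI => sI bI _ fI; case: HJ => sJ bJ _ fJ Hw0 Hw1 sum0.
have [h [h0 hxi hx hy]] := gp_kill_x gp iM.
have [g [g0 gyj gy gx]] := gp_kill_y gp jN.
have ht c v : homL (i + j) c v -> h (ev i j v) = ev i.+1 j v.
  exact: (kill_ev_l gp).
have gt c v : homL (i + j) c v -> g (ev i j v) = ev i j.+1 v.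
  rewrite /homL [(M + N)%N]addnC => Hv.
  exact: (kill_ev_l gps i jN g0 gyj gy gx Hv).
have hb a c v : bihS i.+1 j a c v -> h v = v by exact: kill_bihS_l.
have gb a c v : bihS i j.+1 a c v -> g v = v.
  by move=> /bih_swap; apply: kill_bihS_l.
have coord_hom c d v : coordL (i + j).+1 c d v -> exists e, homL (i + j) e v.
  rewrite /coordL; case: ifP => _ Hv; first by eexists; apply: homLW; exact: Hv.
  by exists 0%N; rewrite Hv; apply: homL0.
have tau_h : h (x i * y j) = 0 by rewrite rmorphM hxi mul0r.
have tau_g : g (x i * y j) = 0 by rewrite rmorphM gyj mulr0.
have xi0 := gp_x_neq0 gp iM; have yj0 := gp_y_neq0 gp jN.
have evE l : ev i j (w0 l + tau (i + j) * w1 l) =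
    ev i j (w0 l) + x i * y j * ev i j (w1 l).
  by rewrite rmorphD rmorphM ev_corner.
move: sum0; under eq_bigr do rewrite evE.
rewrite big_sumType /= => sum0.
have w0J l : w0 (inr l) = 0.
  apply: (fJ b (fun l => w0 (inr l))) => {l} [l|].
    by rewrite addSn; exact: (Hw0 (inr l)).
  have := congr1 h sum0; rewrite rmorph0 rmorphD !rmorph_sum /= big1 => [|l _]; last first.
    by rewrite !rmorphM hxi mul0r mulr0.
  rewrite add0r => sumJ; rewrite -[RHS]sumJ; apply: eq_bigr => l _.
  have [c Hc] := coord_hom _ _ _ (Hw0 (inr l)).
  by rewrite rmorphM rmorphD (ht _ _ Hc) rmorphM tau_h mul0r addr0 (hb _ _ _ (bJ l)).
have {}sum0 : \sum_l (ev i j (w0 (inl l)) + x i * y j * ev i j (w1 (inl l))) * beI l +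
    y j * \sum_l ev i j (w1 (inr l)) * beJ l = 0.
  apply: (mulfI xi0); rewrite mulr0 mulrDr !mulr_sumr -[RHS]sum0.
  congr (_ + _); apply: eq_bigr => l _; first by ring.
  by rewrite w0J rmorph0; ring.
have w0I l : w0 (inl l) = 0.
  apply: (fI b (fun l => w0 (inl l))) => {l} [l|].
    by rewrite addnS; exact: (Hw0 (inl l)).
  have := congr1 g sum0; rewrite rmorph0 rmorphD rmorphM gyj mul0r addr0 rmorph_sum /= => sumI.
  rewrite -[RHS]sumI; apply: eq_bigr => l _.
  have [c Hc] := coord_hom _ _ _ (Hw0 (inl l)).
  by rewrite rmorphM rmorphD (gt _ _ Hc) rmorphM tau_g mul0r addr0 (gb _ _ _ (bI l)).
split; first by case.
apply: (mulfI (mulf_neq0 xi0 yj0)); rewrite mulr0 big_sumType /=.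
rewrite -[RHS](mulr0 (x i)) -[in RHS]sum0 !mulrDr !mulr_sumr.
congr (_ + _); apply: eq_bigr => l _; last by ring.
by rewrite w0I rmorph0; ring.
Qed.

(** Descent on b: a relation is divisible by [tau (i + j)], and the quotient is a relation one
    degree lower. *)
Lemma step_indep b w : (forall l, coordL (i + j) b (bd l) (w l)) ->
  \sum_l ev i j (w l) * be l = 0 -> forall l, w l = 0.
Proof.
have kM : (i + j < (M + N).-1)%N by lia.
have key c v : (forall l, coordL (i + j) c (bd l) (v l)) ->
    \sum_l ev i j (v l) * be l = 0 -> exists v1 : I + J -> Lam,
    [/\ forall l, if c is d.+1 then coordL (i + j) d (bd l) (v1 l) else v1 l = 0,
        \sum_l ev i j (v1 l) * be l = 0 &
        forall l, v l = tau (i + j) * v1 l].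
  move=> Hv sum0; have /choice[w01 Hw01] := fun l => coordL_split kM (Hv l).
  have [|||w00 w10] := @step_indep1 c (fun l => (w01 l).1) (fun l => (w01 l).2).
  - by move=> l; case: (Hw01 l).
  - move=> l; case: (Hw01 l) => _ + _.
    case: (c) => [->|d]; first by exists 0%N; apply: homL0.
    rewrite /coordL; case: ifP => _ Hl; first by eexists; exact: Hl.
    by exists 0%N; rewrite Hl; apply: homL0.
  - by rewrite -[RHS]sum0; apply: eq_bigr => l _; case: (Hw01 l) => _ _ <-.
  exists (fun l => (w01 l).2); split=> // l; first by case: (Hw01 l).
  by case: (Hw01 l) => _ _ ->; rewrite w00 add0r.
elim: b w => [|b IH] w Hw /(key _ _ Hw)[w1 [Hw1 sum1 wE]] l.
  by rewrite wE Hw1 mulr0.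
by rewrite wE (IH w1) ?mulr0.
Qed.

Lemma free_basis_step : free_basis x y M N kap e0 tau ev i j s t ad bd be.
Proof.
case: (HI) => sI bI _ _; case: (HJ) => sJ bJ _ _; split.
- by case=> l /=; [have := sI l; lia|apply: sJ].
- case=> l /=; last by apply: bihSl; exact: bJ.
  by apply: bihomMX; [exists i => //; lia|apply: bihSr; exact: bI].
- exact: step_span.
- exact: step_indep.
Qed.

End Step.

Lemma free_basis_swap x y M N kap e0 tau ev i j s t (I : finType) ad bd be :
  @free_basis y x N M kap e0 tau (fun i j => ev j i) j i t s I bd ad be ->
  @free_basis x y M N kap e0 tau ev i j s t I ad bd be.
Proof.
move=> [H1 H2 H3 H4].
have cE b a l w : (a + s = b + t)%N ->
    coordL N M kap tau (j + i) a (ad l) w = coordL M N kap tau (i + j) b (bd l) w.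
  move=> ab; have := H1 l => sl; rewrite /coordL /homL [(N + M)%N]addnC [(j + i)%N]addnC.
  have -> : (ad l <= a)%N = (bd l <= b)%N by lia.
  by have -> : (a - ad l = b - bd l)%N by lia.
split.
- by move=> l; rewrite H1.
- by move=> l; apply: bih_swap; exact: H2.
- move=> a b u ab Hu; have [|w Hw ->] := H3 b a u _ (bih_swap Hu); first by rewrite ab.
  by exists w => // l; rewrite -(cE _ a).
- move=> b w Hw sum0 l.
  case: (leqP s (b + t)) => [sb|bs].
    apply: (H4 (b + t - s)%N w) => // l'.
    by rewrite (cE b) //; lia.
  by have := Hw l; rewrite /coordL ifF //; have := H1 l; lia.
Qed.

Lemma free_basis_void x y M N kap e0 tau ev i j s t :
  (forall a b u, (a + s = b + t)%N -> bihS x y M N e0 i j a b u -> u = 0) ->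
  @free_basis x y M N kap e0 tau ev i j s t void (fun=> 0%N) (fun=> 0%N) (fun=> 0).
Proof.
move=> H0; split=> //.
move=> a b u ab Hu; exists (fun=> 0) => [[]|].
by rewrite (H0 _ _ _ ab Hu) big1 // => -[].
Qed.

(** Neither an x nor a [tau] is left, so the forms of equal x- and y-degree are the constants of
    K. *)
Lemma free_basis_unit x y M N kap e0 tau ev i j s :
  @generic_pair S Lam x y M N kap e0 tau ev -> (M <= i)%N -> ((M + N).-1 <= i + j)%N ->
  @free_basis x y M N kap e0 tau ev i j s s unit (fun=> 0%N) (fun=> 0%N) (fun=> 1).
Proof.
move=> gp Mi ij; split=> //.
- by move=> _; apply: bihomC; apply: range1.
- move=> a b u; rewrite addnC [RHS]addnC => /addnI <- {b} Hu.
  case: a Hu => [Hu|a Hu]; last first.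
    rewrite (bihomX_empty _ _ Hu) //; first exact: spanned0.
    by move=> z; apply: tail_empty.
  case: (bihomC_inv (range0 e0) (@rangeD _ _ e0) Hu) => r _ <-.
  exists (fun=> kap r); last first.
    by rewrite (big_pred1 tt) => [|[]]; rewrite // (ev_kap gp) mulr1.
  by move=> _; apply: homL_kap.
- move=> b w Hw; rewrite (big_pred1 tt) => [|[]]; rewrite // mulr1 => ev0 -[].
  have := Hw tt; rewrite /coordL /= subn0; case: b {Hw} => [Hw|b Hw].
    case: (bihomC_inv (range0 kap) (@rangeD _ _ kap) Hw) => r _ wE.
    by move: ev0; rewrite -wE (ev_kap gp) => r0; rewrite -(kap_e0 gp) r0 rmorph0.
  apply: (bihomX_empty _ _ Hw) => // z; exact: tail_empty.
Qed.

(** With d = t - s the hypotheses read -(M - i) < d < N - j. Both modules of the step stay in range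
    unless d is minimal; in that case x and y exchange roles. *)
Lemma free_basis_exists x y M N kap e0 tau ev i j s t :
  @generic_pair S Lam x y M N kap e0 tau ev ->
  (i <= M)%N -> (j <= N)%N -> (s + i < t + M)%N -> (t + j < s + N)%N ->
  exists (I : finType) (ad bd : I -> nat) (be : I -> S),
    free_basis x y M N kap e0 tau ev i j s t ad bd be.
Proof.
have [n] := ubnP ((M - i) + (N - j))%N.
elim: n x y M N ev i j s t => // n IH x y M N ev i j s t ltn gp iM jN si tj.
have [Mi|{}iM] := leqP M i.
  do 4!eexists; apply: free_basis_void => a b u ab; apply: bihomX_empty; last by lia.
  by move=> z; apply: tail_empty.
have [Nj|{}jN] := leqP N j.
  do 4!eexists; apply: free_basis_void => a b u ab; apply: bihomY_empty; last by lia.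
  by move=> z; apply: tail_empty.
have [c1|c1] := ltnP (s + i.+1) (t + M).
  have [||||||I [adI [bdI [beI HI]]]] := IH x y M N ev i j.+1 s.+1 t => //; try lia.
  have [||||||J [adJ [bdJ [beJ HJ]]]] := IH x y M N ev i.+1 j s t => //; try lia.
  by do 4!eexists; apply: free_basis_step iM jN _ _ _ _ _ _ _ _ _ _ HI HJ.
have [c2|c2] := ltnP (t + j.+1) (s + N).
  have gps := generic_pair_swap gp.
  have [||||||I [adI [bdI [beI HI]]]] := IH y x N M (fun i j => ev j i) j i.+1 t.+1 s => //; try lia.
  have [||||||J [adJ [bdJ [beJ HJ]]]] := IH y x N M (fun i j => ev j i) j.+1 i t s => //; try lia.
  do 4!eexists; apply: free_basis_swap.
  by apply: (@free_basis_step _ _ _ _ _ _ _ _ gps) HI HJ.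
(* When d is extremal on both sides, d = 0 and each tail is a single variable: the forms of equal
   degrees are polynomials in [x i * y j], with basis 1. *)
have [iM1 jN1 st] : [/\ i.+1 = M, j.+1 = N & s = t] by split; lia.
do 4!eexists; rewrite -{1}st.
apply: (free_basis_step gp iM jN _ (free_basis_unit s gp _ _)); try lia.
apply: free_basis_void => a b u ab; apply: bihomY_empty; last by lia.
by move=> z; apply: tail_empty; lia.
Qed.

End Freeness.

(** * Ideals and flat descent *)

Section IdealTheory.
Variable S : comNzRingType.
Implicit Types (I J K : set S) (A : set S) (F G : {poly S}).

Lemma is_ideal_sum I (T : Type) (r : seq T) (P : pred T) (f : T -> S) :
  is_ideal I -> (forall t, P t -> I (f t)) -> I (\sum_(t <- r | P t) f t).
Proof. by case=> I0 ID _ If; apply: big_ind => //; apply: ID. Qed.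

Lemma is_idealMr I a r : is_ideal I -> I a -> I (a * r).
Proof. by case=> _ _ IM Ia; rewrite mulrC; apply: IM. Qed.

Lemma is_idealN I a : is_ideal I -> I a -> I (- a).
Proof. by case=> _ _ IM Ia; rewrite -mulN1r; apply: IM. Qed.

Lemma is_ideal_setT : is_ideal (@setT S).
Proof. by []. Qed.

Lemma is_ideal_gen A : is_ideal (ideal_gen A).
Proof.
split=> [I [[]]|a b Ha Hb I HI|r a Ha I HI] //; case: (HI) => -[_ ID IM] _.
- by apply: ID; [apply: Ha|apply: Hb].
- by apply: IM; apply: Ha.
Qed.

Lemma sub_ideal_gen A : A `<=` ideal_gen A.
Proof. by move=> a Aa I [_]; apply. Qed.

Lemma ideal_gen_min A I : is_ideal I -> A `<=` I -> ideal_gen A `<=` I.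
Proof. by move=> HI AI a; apply. Qed.

Lemma is_ideal_add I J : is_ideal I -> is_ideal J -> is_ideal (I + J)%ID.
Proof.
case=> I0 ID IM [J0 JD JM]; split.
- by exists 0 => //; exists 0 => //; rewrite addr0.
- move=> _ _ [a Ia [b Jb <-]] [c Ic [d Jd <-]].
  exists (a + c); first exact: ID.
  by exists (b + d); [exact: JD|rewrite addrACA].
- move=> r _ [a Ia [b Jb <-]]; exists (r * a); first exact: IM.
  by exists (r * b); [exact: JM|rewrite mulrDr].
Qed.

Lemma ideal_addl I J : is_ideal J -> I `<=` (I + J)%ID.
Proof. by case=> J0 _ _ a Ia; exists a => //; exists 0 => //; rewrite addr0. Qed.

Lemma ideal_addr I J : is_ideal I -> J `<=` (I + J)%ID.
Proof. by case=> I0 _ _ b Jb; exists 0 => //; exists b => //; rewrite add0r. Qed.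

Lemma ideal_add_min I J K : is_ideal K -> I `<=` K -> J `<=` K ->
  (I + J)%ID `<=` K.
Proof. by case=> _ KD _ IK JK _ [a Ia [b Jb <-]]; apply: KD; auto. Qed.

Lemma is_ideal_mul I J : is_ideal (ideal_mul I J).
Proof. exact: is_ideal_gen. Qed.

Lemma ideal_mulP I J a b : I a -> J b -> ideal_mul I J (a * b).
Proof. by move=> Ia Jb; apply: sub_ideal_gen; exists a => //; exists b. Qed.

Lemma ideal_mul_min I J K : is_ideal K -> (forall a b, I a -> J b -> K (a * b)) ->
  ideal_mul I J `<=` K.
Proof. by move=> HK IJ; apply: ideal_gen_min => // _ [a Ia [b Jb <-]]; apply: IJ. Qed.

Lemma is_ideal_pow I k : is_ideal (I ^ k)%ID.
Proof. by case: k => [|k]; [exact: is_ideal_setT|exact: is_ideal_gen]. Qed.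

Lemma ideal_pow1 I : I `<=` (I ^ 1)%ID.
Proof. by move=> a Ia; rewrite -[a]mulr1; apply: ideal_mulP. Qed.

Lemma ideal_powS I k a b : I a -> (I ^ k)%ID b -> (I ^ k.+1)%ID (a * b).
Proof. exact: ideal_mulP. Qed.

Lemma ideal_powX I k a : I a -> (I ^ k)%ID (a ^+ k).
Proof. by move=> Ia; elim: k => [//|k IH]; rewrite exprS; apply: ideal_powS. Qed.

Lemma ideal_powD I k l a b : (I ^ k)%ID a -> (I ^ l)%ID b -> (I ^ (k + l))%ID (a * b).
Proof.
move=> Ha Hb; elim: k a Ha => [|k IH] a Ha.
  by case: (is_ideal_pow I l) => _ _; apply.
have HK : is_ideal [set c | (I ^ (k.+1 + l))%ID (c * b)].
  case: (is_ideal_pow I (k.+1 + l)) => K0 KD KM; split=> /=.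
  - by rewrite mul0r.
  - by move=> c d Hc Hd; rewrite mulrDl; apply: KD.
  - by move=> r c Hc; rewrite -mulrA; apply: KM.
apply: (ideal_mul_min HK) Ha => c d Ic Hd /=.
by rewrite -mulrA; apply: (@ideal_powS I (k + l)) => //; apply: IH.
Qed.

Lemma ideal_pow_le I k l : (k <= l)%N -> (I ^ l)%ID `<=` (I ^ k)%ID.
Proof.
move=> /subnK <-; elim: (l - k)%N => [//|d IH] a; rewrite addSn => Ha.
apply: IH; move: Ha; apply: ideal_mul_min; first exact: is_ideal_pow.
by case: (is_ideal_pow I (d + k)) => _ _ KM b c _; apply: KM.
Qed.

Lemma ideal_pow_mono I J k : I `<=` J -> (I ^ k)%ID `<=` (J ^ k)%ID.
Proof.
move=> IJ; elim: k => [//|k IH]; apply: ideal_mul_min; first exact: is_ideal_pow.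
by move=> a b Ia Hb; apply: ideal_powS; [apply: IJ|apply: IH].
Qed.

Lemma is_ideal_content F : is_ideal (content F).
Proof. exact: is_ideal_gen. Qed.

Lemma content_coef F k : content F F`_k.
Proof.
have [kF|kF] := ltnP k (size F); first by apply: sub_ideal_gen; apply: mem_nth.
by rewrite nth_default //; case: (is_ideal_content F).
Qed.

Lemma content_min F I : is_ideal I -> (forall k, I F`_k) -> content F `<=` I.
Proof.
by move=> HI HF; apply: ideal_gen_min => // a /= /(nthP 0)[k _ <-].
Qed.

Lemma content_mull F G : content (F * G) `<=` content F.
Proof.
apply: content_min => [|k]; first exact: is_ideal_content.
rewrite coefM; apply: (is_ideal_sum _ (is_ideal_content F)) => i _.
exact: (is_idealMr _ (is_ideal_content F) (@content_coef F i)).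
Qed.

Lemma content_mulr F G : content (F * G) `<=` content G.
Proof. by rewrite mulrC; apply: content_mull. Qed.

End IdealTheory.

Arguments content_coef {S} F k.
Arguments is_ideal_sum {S I T r P f}.
Arguments is_idealMr {S I a r}.
Arguments is_idealN {S I a}.

(** * Extended ideals, bidegree by bidegree *)

Section Descent.
Variables (S : idomainType) (Lam : comNzRingType).
Variables (x y : nat -> S) (M N : nat) (kap : {rmorphism S -> Lam}).
Variables (e0 : {rmorphism S -> S}) (tau : nat -> Lam).
Variable ev : nat -> nat -> {rmorphism Lam -> S}.
Hypothesis gp : generic_pair x y M N kap e0 tau ev.

Local Notation bihS := (bihS x y M N e0 0 0).
Local Notation homL := (homL M N kap tau 0).
Local Notation coordL := (coordL M N kap tau 0).

(** The bidegree (a, b) part of the ideal generated by the image of [I], built from homogeneous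
    elements of [I] only. The bidegree belongs to the predicate because freeness is available only
    for a fixed difference of degrees. *)
Inductive extension (I : set Lam) : nat -> nat -> S -> Prop :=
| extension0 a b : extension I a b 0
| extensionD a b u v : extension I a b u -> extension I a b v ->
    extension I a b (u + v)
| extensionM e l a b u : I l -> homL e l -> bihS a b u ->
    extension I (e + a) (e + b) (ev 0 0 l * u).

Lemma extension_sum I a b (T : Type) (r : seq T) (P : pred T) (f : T -> S) :
  (forall t, P t -> extension I a b (f t)) ->
  extension I a b (\sum_(t <- r | P t) f t).
Proof. by move=> If; apply: big_ind => //; [apply: extension0|apply: extensionD]. Qed.

Lemma extensionMr I a b a' b' u v : extension I a b u -> bihS a' b' v ->
  extension I (a + a') (b + b') (u * v).
Proof.
move=> Hu Hv; elim: Hu => {a b u} [a b|a b u w _ IHu _ IHw|e l a b u Il Hl Hu].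
- by rewrite mul0r; apply: extension0.
- by rewrite mulrDl; apply: extensionD.
- by rewrite -mulrA -!addnA; apply: extensionM => //; apply: bihSM.
Qed.

Lemma extensionMl I a b a' b' u v : extension I a b u -> bihS a' b' v ->
  extension I (a' + a) (b' + b) (v * u).
Proof. by move=> *; rewrite mulrC addnC [(b' + b)%N]addnC; apply: extensionMr. Qed.

Lemma sub_extension I J a b u : I `<=` J -> extension I a b u -> extension J a b u.
Proof.
move=> IJ; elim=> {a b u} [a b|a b u v _ Hu _ Hv|e l a b u Il Hl Hu].
- exact: extension0.
- exact: extensionD.
- by apply: extensionM => //; apply: IJ.
Qed.

Lemma extension_mul I J a b a' b' u v : extension I a b u -> extension J a' b' v ->
  extension (ideal_mul I J) (a + a') (b + b') (u * v).
Proof.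
move=> Hu Hv; elim: Hu => {a b u} [a b|a b u w _ IHu _ IHw|e l a b u Il Hl Hu].
- by rewrite mul0r; apply: extension0.
- by rewrite mulrDl; apply: extensionD.
- elim: Hv => {a' b' v} [a' b'|a' b' v w _ IHv _ IHw|e' l' a' b' v Jl Hl' Hv].
  + by rewrite mulr0; apply: extension0.
  + by rewrite mulrDr; apply: extensionD.
  + rewrite mulrACA -rmorphM (addnACA e a) (addnACA e b).
    apply: extensionM; [exact: ideal_mulP| exact: homLM|exact: bihSM].
Qed.

Lemma extension_sub I K a b u : is_ideal K -> (forall l, I l -> K (ev 0 0 l)) ->
  extension I a b u -> K u.
Proof.
move=> HK IK; case: (HK) => K0 KD _.
elim=> {a b u} [a b|a b u v _ Hu _ Hv|e l a b u Il Hl Hu] //.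
- exact: KD.
- by apply: (is_idealMr HK); apply: IK.
Qed.

(* Flatness: in the range of bidegrees where S is Lam-free, torsion-freeness
   of Lam / I passes to S / I S. *)
Lemma flat_descent (I : set Lam) c a b v :
  is_ideal I -> (b < a + M)%N -> (a < b + N)%N ->
  (forall e w, homL e w -> I (kap c * w) -> I w) ->
  bihS a b v -> extension I a b (e0 c * v) -> extension I a b v.
Proof.
move=> HI ba ab Ic Hv Hcv; case: (HI) => I0 ID IM.
have [||B [ad [bd [be [degB homB spanB indB]]]]] :=
  (* The choice s = b, t = a selects the module of forms with the same difference of degrees as
     [v]. *)
  free_basis_exists (s := b) (t := a) gp (leq0n M) (leq0n N); [lia|lia|].
have bihB l : bihS (ad l) (bd l) (be l) by exact: homB.
have span a' b' u : (a' + b = b' + a)%N -> bihS a' b' u -> exists2 w : B -> Lam,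
    (forall l, coordL b' (bd l) (w l)) & u = \sum_l ev 0 0 (w l) * be l.
  exact: spanB.
have coordI a' b' u : (a' + b = b' + a)%N -> extension I a' b' u ->
    exists2 w : B -> Lam, (forall l, coordL b' (bd l) (w l) /\ I (w l)) &
    u = \sum_l ev 0 0 (w l) * be l.
  move=> ab' Hu; elim: Hu ab' => {a' b' u} [a' b'|a' b' u w _ IHu _ IHw|e l a' b' u Il Hl Hu] ab'.
  - exists (fun=> 0) => [l|]; first by split=> //; apply: coordL0.
    by rewrite big1 // => l _; rewrite rmorph0 mul0r.
  - have [w1 Hw1 ->] := IHu ab'; have [w2 Hw2 ->] := IHw ab'.
    exists (fun l => w1 l + w2 l) => [l|].
      case: (Hw1 l) (Hw2 l) => H1 I1 [H2 I2]; split; last exact: ID.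
      exact: coordLD.
    by rewrite -big_split; apply: eq_bigr => l _; rewrite rmorphD mulrDl.
  - have [|w Hw ->] := span a' b' u _ Hu; first by lia.
    exists (fun k => l * w k) => [k|].
      by split; [apply: coordLM|apply: (is_idealMr HI)].
    by rewrite mulr_sumr; apply: eq_bigr => k _; rewrite rmorphM mulrA.
have [|w Hw ev_w] := span a b v _ Hv; first by lia.
have [|w' Hw' ecv] := coordI a b _ _ Hcv; first by lia.
have Iw l : I (w l).
  case: (leqP (bd l) b) => bl; last first.
    by have := Hw l; rewrite /coordL ifF => [->//|]; lia.
  have Hwl : homL (b - bd l) (w l) by have := Hw l; rewrite /coordL bl.
  apply: (Ic _ _ Hwl).
  (* Both families are coordinates of [e0 c * v], and coordinates are unique. *)
  have -> : kap c * w l = w' l by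
    apply/eqP; rewrite -subr_eq0; apply/eqP;
    apply: (indB b (fun l => kap c * w l - w' l)) => [k|];
    [apply: coordLD; [exact: (coordLM (homL_kap _ _ _ _ _ c) (Hw k))
                     |apply: coordLN; exact: (Hw' k).1]
    |under eq_bigr do rewrite rmorphB rmorphM (ev_kap gp) mulrBl -mulrA;
     rewrite sumrB -mulr_sumr -ev_w ecv subrr].
  exact: (Hw' l).2.
rewrite ev_w; apply: extension_sum => l _.
have := Hw l; rewrite /coordL; case: ifP => bl Hwl; last first.
  by rewrite Hwl rmorph0 mul0r; apply: extension0.
have dl := degB l; have -> : a = (b - bd l + ad l)%N by lia.
by have := extensionM (Iw l) Hwl (bihB l); rewrite subnK.
Qed.

End Descent.

(** * Gradings of a polynomial ring *)

Section Substitution.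
Variables (R : idomainType) (n n' : nat).

Lemma eq_mpoly_morph (T : comNzRingType) (g h : {rmorphism {mpoly R[n]} -> T}) :
  (forall c, g c%:MP = h c%:MP) -> (forall i, g 'X_i = h 'X_i) -> g =1 h.
Proof.
move=> gC gX u; rewrite [u]mpolyE !rmorph_sum; apply: eq_bigr => m _.
rewrite -mul_mpolyC !rmorphM gC mpolyXE_id !rmorph_prod; congr (_ * _).
by apply: eq_bigr => i _; rewrite !rmorphXn gX.
Qed.

Definition subst (h : 'I_n -> {mpoly R[n']}) :
  {rmorphism {mpoly R[n]} -> {mpoly R[n']}} := mmap (@mpolyC n' R) h.

Lemma substC h c : subst h c%:MP = c%:MP.
Proof. exact: mmapC. Qed.

Lemma substX h i : subst h 'X_i = h i.
Proof. by rewrite [LHS]mmapX mmap1U. Qed.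

End Substitution.

Section Grading.
Variables (R : idomainType) (n : nat).
Local Notation S := {mpoly R[n]}.
Implicit Types (V W : pred 'I_n) (u v : S) (m : 'X_{1..n}).

(** A retraction of S onto the polynomials in the variables outside [V]; this realizes K as a
    subring of S. *)
Definition kill V : {rmorphism S -> S} := subst (fun k => if V k then 0 else 'X_k).

Lemma kill_kill V W u : subpred W V -> kill W (kill V u) = kill V u.
Proof.
move=> WV.
have := @eq_mpoly_morph R n _ (kill W \o kill V : {rmorphism S -> S}) (kill V).
apply=> [c|i] /=; first by rewrite !substC.
rewrite !substX; case: ifP => Vi; first by rewrite rmorph0.
by rewrite substX; case: ifP => // /WV; rewrite Vi.
Qed.

Definition deg V m : nat := (\sum_(k | V k) m k)%N.

Lemma degD V m1 m2 : deg V (m1 + m2)%MM = (deg V m1 + deg V m2)%N.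
Proof. by rewrite /deg -big_split; apply: eq_bigr => k _; rewrite mnmDE. Qed.

Lemma deg0 V : deg V 0%MM = 0%N.
Proof. by rewrite /deg big1 // => k _; rewrite mnm0E. Qed.

Lemma deg1 V i : deg V U_(i)%MM = V i.
Proof.
rewrite /deg; case Vi : (V i).
  rewrite (bigD1 i) //= mnm1E eqxx big1 ?addn0 // => k /andP[_ ki].
  by rewrite mnm1E eq_sym (negbTE ki).
rewrite big1 // => k Vk; rewrite mnm1E; case: eqP => // ik.
by rewrite -ik Vi in Vk.
Qed.

Definition proj V (a : nat) u : S := \sum_(m <- msupp u | deg V m == a) u@_m *: 'X_[m].

Lemma mcoeff_proj V a u m : (proj V a u)@_m = if deg V m == a then u@_m else 0.
Proof.
rewrite /proj raddf_sum /=.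
under eq_bigr do rewrite mcoeffZ mcoeffX.
have [mu|mu] := boolP (m \in msupp u); last first.
  rewrite (memN_msupp_eq0 mu) if_same big_seq_cond big1 // => k /andP[ku _].
  by case: eqP => [km|]; rewrite ?mulr0 // -km ku in mu *.
rewrite big_mkcond (bigD1_seq m) ?msupp_uniq //= eqxx mulr1 big1 ?addr0 // => k km.
by rewrite (negbTE km) mulr0 if_same.
Qed.

Lemma projD V a u v : proj V a (u + v) = proj V a u + proj V a v.
Proof.
apply/mpolyP => m; rewrite mcoeffD !mcoeff_proj mcoeffD.
by case: ifP; rewrite ?addr0.
Qed.

Lemma proj0 V a : proj V a 0 = 0.
Proof. by rewrite /proj msupp0 big_nil. Qed.

Lemma proj_sum V a (T : Type) (r : seq T) (P : pred T) (F : T -> S) :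
  proj V a (\sum_(i <- r | P i) F i) = \sum_(i <- r | P i) proj V a (F i).
Proof. by apply: (big_morph (proj V a)); [exact: projD|exact: proj0]. Qed.

Lemma projZX V a c m :
  proj V a (c *: 'X_[m]) = if deg V m == a then c *: 'X_[m] else 0.
Proof.
apply/mpolyP => k; rewrite mcoeff_proj.
have [->|km] := eqVneq m k; first by case: ifP; rewrite ?mcoeff0.
have z : (c *: 'X_[m])@_k = 0 by rewrite mcoeffZ mcoeffX (negbTE km) mulr0.
by rewrite z if_same; case: ifP; rewrite ?mcoeff0.
Qed.

Lemma projMX V a c m u : proj V a (c *: 'X_[m] * u) =
  if (deg V m <= a)%N then c *: 'X_[m] * proj V (a - deg V m)%N u else 0.
Proof.
rewrite {1}[u]mpolyE mulr_sumr proj_sum.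
have E k : proj V a (c *: 'X_[m] * (u@_k *: 'X_[k])) =
    if (deg V m <= a)%N then
      c *: 'X_[m] * proj V (a - deg V m)%N (u@_k *: 'X_[k]) else 0.
  rewrite -scalerAl -scalerAr scalerA -mpolyXD !projZX degD.
  case: leqP => ma; last by rewrite ifF //; lia.
  have -> : (deg V m + deg V k == a)%N = (deg V k == a - deg V m)%N by lia.
  by case: ifP; rewrite ?mulr0 // -scalerAl -scalerAr scalerA mpolyXD.
under eq_bigr do rewrite E.
case: ifP => _; last by rewrite big1.
by rewrite -mulr_sumr -proj_sum -mpolyE.
Qed.

Lemma projC V W a b u : proj V a (proj W b u) = proj W b (proj V a u).
Proof. by apply/mpolyP => m; rewrite !mcoeff_proj; do 2!case: eqP. Qed.

Lemma proj_id V a u : proj V a (proj V a u) = proj V a u.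
Proof. by apply/mpolyP => m; rewrite !mcoeff_proj; case: eqP. Qed.

Definition homdeg V (d : nat) u := forall m, m \in msupp u -> deg V m = d.

Lemma proj_homdeg V d a u : homdeg V d u -> proj V a u = if a == d then u else 0.
Proof.
move=> Hu; apply/mpolyP => m; rewrite mcoeff_proj.
have [mu|/memN_msupp_eq0 mu] := boolP (m \in msupp u).
  by rewrite (Hu m mu) eq_sym; case: (a == d); rewrite ?mcoeff0.
by rewrite mu if_same; case: ifP => _; rewrite ?mcoeff0 ?mu.
Qed.

Lemma homdeg_proj V a u : homdeg V a (proj V a u).
Proof.
move=> m; rewrite mcoeff_msupp mcoeff_proj.
by case: ifP => [/eqP //|_]; rewrite eqxx.
Qed.

Lemma homdegP V d u : homdeg V d u <-> proj V d u = u.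
Proof.
split=> [Hu|<-]; last exact: homdeg_proj.
by rewrite (proj_homdeg _ Hu) eqxx.
Qed.

Lemma homdeg0 V d : homdeg V d 0.
Proof. by move=> m; rewrite msupp0. Qed.

Lemma homdegC V c : homdeg V 0 c%:MP.
Proof. by move=> m; rewrite msuppC; case: eqP => // _; rewrite inE => /eqP->; apply: deg0. Qed.

Lemma homdegX V i : homdeg V (V i) 'X_i.
Proof. by move=> m; rewrite msuppX inE => /eqP->; apply: deg1. Qed.

Lemma homdegD V d u v : homdeg V d u -> homdeg V d v -> homdeg V d (u + v).
Proof. by rewrite !homdegP projD => -> ->. Qed.

Lemma homdegM V d e u v : homdeg V d u -> homdeg V e v -> homdeg V (d + e) (u * v).
Proof.
move=> Hu Hv m /msuppM_le /allpairsP[[m1 m2] /= [/Hu e1 /Hv e2 ->]].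
by rewrite degD e1 e2.
Qed.

Lemma homdeg_sum V d (T : eqType) (r : seq T) (P : pred T) (F : T -> S) :
  (forall i, i \in r -> P i -> homdeg V d (F i)) ->
  homdeg V d (\sum_(i <- r | P i) F i).
Proof.
move=> HF; rewrite big_seq_cond; apply: big_ind; first exact: homdeg0.
  by move=> u v; apply: homdegD.
by move=> i /andP[]; apply: HF.
Qed.

Lemma homdeg_kill V W u : subpred W V -> homdeg W 0 (kill V u).
Proof.
move=> WV; rewrite [u]mpolyE rmorph_sum; apply: homdeg_sum => m _ _.
rewrite -mul_mpolyC rmorphM substC -[0%N]addn0; apply: homdegM; first exact: homdegC.
rewrite mpolyXE_id rmorph_prod; apply: (big_ind (homdeg W 0)).
- by rewrite -mpolyC1; apply: homdegC.
- by move=> p q Hp Hq; rewrite -[0%N]addn0; apply: homdegM.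
move=> k _; rewrite rmorphXn substX.
have Hk : homdeg W 0 (if V k then 0 else 'X_k : S).
  case: ifP => Vk; first exact: homdeg0.
  have := @homdegX W k; case Wk : (W k) => //.
  by rewrite WV in Vk.
elim: (m k) => [|e IH]; first by rewrite expr0 -mpolyC1; apply: homdegC.
by rewrite exprS -[0%N]addn0; apply: homdegM.
Qed.

Lemma projM_homdeg V d a u v : homdeg V d u ->
  proj V a (u * v) = if (d <= a)%N then u * proj V (a - d)%N v else 0.
Proof.
move=> Hu; rewrite {1 2}[u]mpolyE !mulr_suml proj_sum.
have E m : m \in msupp u -> proj V a (u@_m *: 'X_[m] * v) =
    if (d <= a)%N then u@_m *: 'X_[m] * proj V (a - d)%N v else 0.
  by move=> mu; rewrite projMX (Hu m mu).
rewrite big_seq (eq_bigr _ E) -big_seq; case: ifP => // _.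
by rewrite big1.
Qed.

Lemma projM0 V a u v : homdeg V 0 u -> proj V a (u * v) = u * proj V a v.
Proof. by move=> Hu; rewrite (projM_homdeg _ _ Hu) subn0. Qed.

Lemma proj_ind V (P : set S) u : P 0 -> (forall v w, P v -> P w -> P (v + w)) ->
  (forall a, P (proj V a u)) -> P u.
Proof.
move=> P0 PD Pu; set K := (\max_(m <- msupp u) deg V m).+1.
have -> : u = \sum_(a < K) proj V a u.
  apply/mpolyP => m; rewrite raddf_sum /=.
  under eq_bigr do rewrite mcoeff_proj.
  have [mu|/memN_msupp_eq0 mu] := boolP (m \in msupp u); last first.
    by rewrite big1 ?mu // => a _; rewrite if_same.
  have mK : (deg V m < K)%N by rewrite ltnS; apply: leq_bigmax_seq.
  rewrite (bigD1 (Ordinal mK)) //= eqxx big1 ?addr0 // => a aK.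
  by rewrite ifF //; apply: contra_neqF aK => /eqP ma; apply/val_inj.
by apply: big_ind.
Qed.

(** Reduces a property of all components of all elements of an ideal to generators, through
    minimality of the generated ideal. *)
Lemma graded_ideal V (Q : nat -> set S) : (forall a, Q a 0) ->
  (forall a u v, Q a u -> Q a v -> Q a (u + v)) ->
  (forall a c m u, Q a u -> Q (deg V m + a)%N (c *: 'X_[m] * u)) ->
  is_ideal [set u | forall a, Q a (proj V a u)].
Proof.
move=> Q0 QD QM; split=> /= [a|u v Hu Hv a|r u Hu a].
- by rewrite proj0.
- by rewrite projD; apply: QD.
- rewrite {1}[r]mpolyE mulr_suml proj_sum.
  apply: (big_ind (Q a)) => // [v w|m _]; first exact: QD.
  by rewrite projMX; case: ifP => // ma; rewrite -{1}(subnKC ma); apply: QM.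
Qed.

Lemma bigraded_ideal V W (Q : nat -> nat -> set S) : (forall a b, Q a b 0) ->
  (forall a b u v, Q a b u -> Q a b v -> Q a b (u + v)) ->
  (forall a b c m u, Q a b u -> Q (deg V m + a)%N (deg W m + b)%N (c *: 'X_[m] * u)) ->
  is_ideal [set u | forall a b, Q a b (proj V a (proj W b u))].
Proof.
move=> Q0 QD QM; split=> /= [a b|u v Hu Hv a b|r u Hu a b].
- by rewrite !proj0.
- by rewrite !projD; apply: QD.
- rewrite {1}[r]mpolyE mulr_suml [proj W b _]proj_sum proj_sum.
  apply: (big_ind (Q a b)) => // [v w|m _]; first exact: QD.
  rewrite projMX; case: ifP => mb; last by rewrite proj0.
  rewrite projMX; case: ifP => ma //.
  by rewrite -{1}(subnKC ma) -{1}(subnKC mb); apply: QM.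
Qed.

Definition graded V (I : set S) := forall a u, I u -> I (proj V a u).

Lemma graded_add V I J : graded V I -> graded V J -> graded V (I + J)%ID.
Proof.
move=> gI gJ a _ [u Iu [v Jv <-]]; rewrite projD.
by exists (proj V a u); [exact: gI|exists (proj V a v) => //; exact: gJ].
Qed.

Lemma graded_mul V I J : is_ideal J ->
  graded V I -> graded V J -> graded V (ideal_mul I J).
Proof.
move=> HJ gI gJ; case: (is_ideal_mul I J) => M0 MD MM.
suff sub : ideal_mul I J `<=` [set u | forall a, ideal_mul I J (proj V a u)].
  by move=> a u /sub; apply.
apply: ideal_mul_min.
  by apply: (graded_ideal (Q := fun=> ideal_mul I J)) => // a c m u; apply: MM.
move=> u v Iu Jv /= a; apply: (proj_ind (V := V) (u := u)
  (P := [set u | ideal_mul I J (proj V a (u * v))])) => /= [|u1 u2|b].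
- by rewrite mul0r proj0.
- by rewrite mulrDl projD; apply: MD.
- rewrite (projM_homdeg _ _ (@homdeg_proj V b u)); case: ifP => // _.
  by apply: ideal_mulP; [apply: gI|apply: gJ].
Qed.

Lemma graded_pow V I k : graded V I -> graded V (I ^ k)%ID.
Proof.
move=> gI; elim: k => [//|k IH]; apply: graded_mul => //; exact: is_ideal_pow.
Qed.

Lemma graded_content V d (F : {poly S}) : (forall k, homdeg V d F`_k) -> graded V (content F).
Proof.
move=> HF; suff sub : content F `<=` [set u | forall a, content F (proj V a u)].
  by move=> a u /sub; apply.
apply: content_min.
  have [_ D Mu] := is_ideal_content F.
  apply: (graded_ideal (Q := fun=> content F)) => // *; last by apply: Mu.
  by case: (is_ideal_content F).
move=> k /= a; rewrite (proj_homdeg _ (HF k)); case: ifP => _.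
  exact: content_coef.
by case: (is_ideal_content F).
Qed.

End Grading.

(** * Contents of polynomials with given coefficients *)

Section Fpoly.
Variable A : comNzRingType.
Implicit Types x y z : nat -> A.

Definition fpoly x M : {poly A} := \sum_(i < M) x i *: 'X^i.

Lemma coef_fpoly x M k : (fpoly x M)`_k = if (k < M)%N then x k else 0.
Proof.
rewrite coef_sum; case: ltnP => kM.
  rewrite (bigD1 (Ordinal kM)) //= coefZ coefXn eqxx mulr1 big1 ?addr0 // => i.
  rewrite -val_eqE /= coefZ coefXn eq_sym => /negbTE ->; by rewrite mulr0.
by rewrite big1 // => i _; rewrite coefZ coefXn gtn_eqF ?mulr0 //; have := ltn_ord i; lia.
Qed.

Lemma pcoef_large x y M N k : ((M + N).-1 <= k)%N -> pcoef x y M N 0 0 k = 0.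
Proof.
move=> Hk; rewrite /pcoef big_nat big1 // => a Ha.
by rewrite big_nat_cond big1 // => b /andP[Hb /eqP]; lia.
Qed.

Lemma coef_fpolyM x y M N k :
  (fpoly x M * fpoly y N)`_k = pcoef x y M N 0 0 k.
Proof.
rewrite /fpoly /pcoef mulr_suml coef_sum big_mkord; apply: eq_bigr => i _.
rewrite mulr_sumr coef_sum big_mkord [RHS]big_mkcond; apply: eq_bigr => j _.
rewrite -scalerAl -scalerAr scalerA -exprD coefZ coefXn eq_sym.
by case: eqP; rewrite ?mulr1 ?mulr0.
Qed.

Lemma fpolyM x y M N :
  fpoly x M * fpoly y N = fpoly (pcoef x y M N 0 0) (M + N).-1.
Proof.
apply/polyP => k; rewrite coef_fpolyM coef_fpoly.
by case: ltnP => // Hk; rewrite pcoef_large.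
Qed.

Lemma content_fpoly x M (I : set A) : is_ideal I -> (forall i, (i < M)%N -> I (x i)) ->
  content (fpoly x M) `<=` I.
Proof.
move=> HI Ix; apply: content_min => // k; rewrite coef_fpoly; case: ifP => kM.
  exact: Ix.
by case: HI.
Qed.

Lemma content_fpoly_var x M i : (i < M)%N -> content (fpoly x M) (x i).
Proof. by move=> iM; have := content_coef (fpoly x M) i; rewrite coef_fpoly iM. Qed.

Lemma bih_pow C x y M N a b u : bih C x y M N 0 0 a b u ->
  (content (fpoly x M) ^ a)%ID u /\ (content (fpoly y N) ^ b)%ID u.
Proof.
elim=> {a b u} [c _|a b|a b u v _ [Hu Hu'] _ [Hv Hv']|z a b u [i iM ->] _ [Hu Hu']|z a b u [j jN ->] _ [Hu Hu']].
- by [].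
- by split; [case: (is_ideal_pow (content (fpoly x M)) a)|case: (is_ideal_pow (content (fpoly y N)) b)].
- split; first by case: (is_ideal_pow (content (fpoly x M)) a) => _ D _; apply: D.
  by case: (is_ideal_pow (content (fpoly y N)) b) => _ D _; apply: D.
- split; first by apply: ideal_powS => //; apply: content_fpoly_var.
  by case: (is_ideal_pow (content (fpoly y N)) b) => _ _; apply.
- split; last by apply: ideal_powS => //; apply: content_fpoly_var.
  by case: (is_ideal_pow (content (fpoly x M)) a) => _ _; apply.
Qed.

Lemma is_ideal_bih x y M N a b : is_ideal [set u | bih setT x y M N 0 0 a b u].
Proof.
split=> /= [|u v|r u Hu]; [exact: bihom0|exact: bihomD|].
by apply: (@bihomM _ _ _ _ 0 0 a b) => //; apply: bihomC.
Qed.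

(** With all of the ring as coefficients, a power of a content consists of forms; this carries the
    degreewise Dedekind-Mertens lemma over to ideals. *)
Lemma pow_bih x y M N a u : (content (fpoly x M) ^ a)%ID u ->
  bih setT x y M N 0 0 a 0 u.
Proof.
elim: a u => [|a IH] u; first by move=> _; apply: bihomC.
have HK := is_ideal_bih x y M N a.+1 0; apply: (ideal_mul_min HK) => {u} p q Hp Hq.
suff : content (fpoly x M) `<=` [set p | bih setT x y M N 0 0 a.+1 0 (p * q)] by apply.
apply: content_fpoly => [|i iM] /=; last by apply: bihomMX; [exists i|apply: IH].
case: HK => K0 KD KM; split=> /= [|v w|r v].
- by rewrite mul0r.
- by rewrite mulrDl; apply: KD.
- by rewrite -mulrA; apply: KM.
Qed.

Lemma pspan_content C x y M N a b u : pspan C x y M N 0 0 a b u ->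
  content (fpoly x M * fpoly y N) u.
Proof.
move=> [v _ ->]; apply: (is_ideal_sum (is_ideal_content _)) => k _.
apply: (is_idealMr (is_ideal_content _)); rewrite -coef_fpolyM.
exact: content_coef.
Qed.

Lemma Dedekind_Mertens_content x y M N u v :
  (content (fpoly x M) ^ N)%ID u -> content (fpoly y N) v ->
  content (fpoly x M * fpoly y N) (u * v).
Proof.
move=> /(pow_bih y N) Hu /ideal_pow1 /(pow_bih x M) /bih_swap Hv.
apply: (@pspan_content setT _ _ _ _ N.-1 0); apply: Dedekind_Mertens => //.
  by rewrite subn0.
by have := bihomM (fun _ _ _ _ => I) Hu Hv; rewrite addn0.
Qed.

Lemma ideal_map (B : comNzRingType) (h : {rmorphism A -> B}) (J : set B) :
  is_ideal J -> is_ideal [set u | J (h u)].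
Proof.
case=> J0 JD JM; split=> /= [|u v|r u]; first by rewrite rmorph0.
  by rewrite rmorphD; apply: JD.
by rewrite rmorphM; apply: JM.
Qed.

Lemma pow_map (B : comNzRingType) (h : {rmorphism A -> B}) (I : set A) (J : set B) k :
  (forall u, I u -> J (h u)) -> forall u, (I ^ k)%ID u -> (J ^ k)%ID (h u).
Proof.
move=> IJ; elim: k => [//|k IH] u Hu.
have HK := ideal_map h (is_ideal_pow J k.+1).
apply: (ideal_mul_min HK _ Hu) => p q Hp Hq /=.
by rewrite rmorphM; apply: ideal_powS; [apply: IJ|apply: IH].
Qed.

Lemma content_map (B : comNzRingType) (h : {rmorphism A -> B}) (F : {poly A}) u :
  content F u -> content (map_poly h F) (h u).
Proof.
move=> Hu; have HK := ideal_map h (is_ideal_content (map_poly h F)).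
apply: (content_min HK _ Hu) => k /=; rewrite -coef_map; exact: content_coef.
Qed.

Lemma eq_fpoly x x' M : (forall i, (i < M)%N -> x i = x' i) -> fpoly x M = fpoly x' M.
Proof. by move=> E; apply: eq_bigr => i _; rewrite E. Qed.

End Fpoly.

Lemma map_fpoly (A B : comNzRingType) (h : {rmorphism A -> B}) (x : nat -> A) M :
  map_poly h (fpoly x M) = fpoly (h \o x) M.
Proof. by apply/polyP => k; rewrite coef_map !coef_fpoly; case: ltnP => _ /=; rewrite ?rmorph0. Qed.

Arguments bih_pow {A C x y M N a b u}.

Section Variables.
Variables (R : idomainType) (n : nat).
Local Notation S := {mpoly R[n]}.
Implicit Types (v w : nat -> 'I_n) (M N : nat).

Definition inj_lt v M := forall i j, (i < M)%N -> (j < M)%N -> v i = v j -> i = j.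
Definition disj_lt v M w N := forall i j, (i < M)%N -> (j < N)%N -> v i <> w j.
Definition vars v M : pred 'I_n := fun k => [exists i : 'I_M, v i == k].
Definition pvar v (i : nat) : S := 'X_(v i).

Lemma varsP v M k : reflect (exists2 i, (i < M)%N & v i = k) (vars v M k).
Proof.
apply: (iffP existsP) => [[i /eqP <-]|[i iM <-]]; first by exists i.
by exists (Ordinal iM) => /=.
Qed.

Lemma vars_in v M i : (i < M)%N -> vars v M (v i).
Proof. by move=> iM; apply/varsP; exists i. Qed.

Lemma disj_ltC v M w N : disj_lt v M w N -> disj_lt w N v M.
Proof. by move=> H i j iM jN /esym; apply: H. Qed.

Lemma disj_vars v M w N k : disj_lt v M w N -> vars v M k -> ~~ vars w N k.
Proof. by move=> H /varsP[i iM <-]; apply/varsP => -[j jN /esym]; apply: H. Qed.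

End Variables.

(** * Two generic polynomials in a polynomial ring *)

Section Pair.
Variables (R : idomainType) (n : nat) (vx vy : nat -> 'I_n) (M N : nat).
Local Notation S := {mpoly R[n]}.
Local Notation Lam := {mpoly R[(M + N).+1 + n]}.
Local Notation x := (@pvar R n vx).
Local Notation y := (@pvar R n vy).

Definition vxy : pred 'I_n := fun k => vars vx M k || vars vy N k.

Definition lift_xy : {rmorphism S -> Lam} :=
  subst (fun k => if vxy k then 0 else 'X_(rshift (M + N).+1 k)).

(** [Lam] consists of a block for the [tau k] and a copy of all n variables, of which [lift_xy] uses
    only those outside x and y. The successor in the size of the first block makes its index type
    nonempty, as [inord] requires. *)
Definition tau (k : nat) : Lam := 'X_(lshift n (inord k)).

Definition ev_xy (i j : nat) : {rmorphism Lam -> S} :=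
  subst (fun k => match split k with
    | inl t => pcoef x y M N i j t
    | inr k => if vxy k then 0 else 'X_k
    end).

Hypotheses (injx : inj_lt vx M) (injy : inj_lt vy N) (disj : disj_lt vx M vy N).

Lemma mpolyXi_neq0 (k : 'I_n) : ('X_k : S) != 0.
Proof.
apply/eqP => /(congr1 (mcoeff U_(k))); rewrite mcoeffX eqxx mcoeff0.
by move/eqP; rewrite oner_eq0.
Qed.

Lemma generic_pair_xy : generic_pair x y M N lift_xy (kill R vxy) tau ev_xy.
Proof.
split.
- move=> i j s.
  have := @eq_mpoly_morph R n _ (ev_xy i j \o lift_xy : {rmorphism S -> S}) (kill R vxy).
  apply=> [c|k] /=; first by rewrite !substC.
  rewrite !substX; case: ifP => Vk; first by rewrite rmorph0.
  by rewrite substX (unsplitK (inr k)) Vk.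
- move=> s.
  have := @eq_mpoly_morph R n _ (lift_xy \o kill R vxy : {rmorphism S -> Lam}) lift_xy.
  apply=> [c|k] /=; first by rewrite !substC.
  by rewrite !substX; case: ifP => Vk; rewrite ?rmorph0 // substX Vk.
- by move=> i j k Hk; rewrite substX (unsplitK (inl _)) inordK //; lia.
- by move=> i _; apply: mpolyXi_neq0.
- by move=> j _; apply: mpolyXi_neq0.
- move=> i iM; exists (kill R (pred1 (vx i))); split.
  + move=> s; apply: kill_kill => k /= /eqP ->.
    by rewrite /vxy vars_in.
  + by rewrite substX /= eqxx.
  + move=> k kM ki; rewrite substX /= ifF //; apply: contraNF ki => /eqP e.
    by rewrite (injx kM iM e).
  + move=> j jN; rewrite substX /= ifF //; apply/eqP => e.
    by apply: (disj iM jN).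
- move=> j jN; exists (kill R (pred1 (vy j))); split.
  + move=> s; apply: kill_kill => k /= /eqP ->.
    by rewrite /vxy vars_in ?orbT.
  + by rewrite substX /= eqxx.
  + move=> k kN kj; rewrite substX /= ifF //; apply: contraNF kj => /eqP e.
    by rewrite (injy kN jN e).
  + move=> i iM; rewrite substX /= ifF //; apply/eqP => e.
    by apply: (disj iM jN).
Qed.

Local Notation bihxy := (bihS x y M N (kill R vxy) 0 0).

Lemma bih_mon m : bihxy (deg (vars vx M) m) (deg (vars vy N) m) 'X_[m].
Proof.
rewrite mpolyXE_id /deg (big_mkcond (vars vx M)) (big_mkcond (vars vy N)).
apply: (big_rec3 (fun a b u => bihxy a b u)) => [|k a b u _ Hu].
  by apply: bihomC; apply: range1.
apply: bihSM => //; elim: (m k) => [|e IH].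
  by rewrite !if_same expr0; apply: bihomC; apply: range1.
have Hk : bihxy (vars vx M k) (vars vy N k) 'X_k.
  case Xk : (vars vx M k).
    rewrite (negbTE (disj_vars disj Xk)) /=.
    by case/varsP: Xk => i iM <-; apply: bih_var_l => //; apply: range1.
  case Yk : (vars vy N k).
    by case/varsP: Yk => i iM <-; apply: bih_var_r => //; apply: range1.
  by apply: bihomC; exists 'X_k => //; rewrite substX /vxy Xk Yk.
have := bihSM Hk IH; rewrite -exprS.
by case: (vars vx M k); case: (vars vy N k); rewrite ?add1n ?add0n.
Qed.

Lemma bih_homdeg a b u :
  homdeg (vars vx M) a u -> homdeg (vars vy N) b u -> bihxy a b u.
Proof.
move=> Hx Hy; rewrite [u]mpolyE big_seq; apply: bihom_sum => m mu.
rewrite -(Hx m mu) -(Hy m mu) -mul_mpolyC.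
have HC : bihxy 0 0 (u@_m)%:MP.
  by apply: bihomC; exists (u@_m)%:MP => //; rewrite substC.
exact: (bihSM HC (bih_mon m)).
Qed.

Lemma bih_proj a b u : bihxy a b (proj (vars vx M) a (proj (vars vy N) b u)).
Proof. by apply: bih_homdeg; [|rewrite projC]; apply: homdeg_proj. Qed.

End Pair.

(** * The ideals L(f, g) *)

Section L2.
Variable A : comNzRingType.
Implicit Types (x y : nat -> A) (K : set A).

(* M and N count the coefficients, so that N = deg g + 1 and M = deg f + 1. *)
Definition L2 x M y N : set A :=
  (content (fpoly x M * fpoly y N) + content (fpoly x M) ^ N
   + content (fpoly y N) ^ M)%ID.

Lemma is_ideal_L2 x M y N : is_ideal (L2 x M y N).
Proof.
apply: is_ideal_add; last exact: is_ideal_pow.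
by apply: is_ideal_add; [exact: is_ideal_content|exact: is_ideal_pow].
Qed.

Lemma L2_min x M y N K : is_ideal K -> content (fpoly x M * fpoly y N) `<=` K ->
  (content (fpoly x M) ^ N)%ID `<=` K -> (content (fpoly y N) ^ M)%ID `<=` K ->
  L2 x M y N `<=` K.
Proof. by move=> HK K1 K2 K3; do 2!apply: ideal_add_min => //. Qed.

Lemma L2_fg x M y N : content (fpoly x M * fpoly y N) `<=` L2 x M y N.
Proof. by move=> u Hu; do 2!(apply: ideal_addl; first exact: is_ideal_pow). Qed.

Lemma L2_f x M y N : (content (fpoly x M) ^ N)%ID `<=` L2 x M y N.
Proof.
move=> u Hu; apply: ideal_addl; first exact: is_ideal_pow.
by apply: ideal_addr; first exact: is_ideal_content.
Qed.

Lemma L2_g x M y N : (content (fpoly y N) ^ M)%ID `<=` L2 x M y N.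
Proof.
apply: ideal_addr; apply: is_ideal_add; first exact: is_ideal_content.
exact: is_ideal_pow.
Qed.

Lemma L2_swap x M y N : L2 x M y N `<=` L2 y N x M.
Proof.
apply: L2_min; [exact: is_ideal_L2| |exact: L2_g|exact: L2_f].
by rewrite mulrC; apply: L2_fg.
Qed.

End L2.

(** * Homogeneous components of powers of contents *)

Section HomogeneousContent.
Variables (R : idomainType) (n : nat).
Local Notation S := {mpoly R[n]}.
Implicit Types (V : pred 'I_n) (x y : nat -> S).

Lemma homdeg_coef V d x M k : (forall i, (i < M)%N -> homdeg V d (x i)) ->
  homdeg V d (fpoly x M)`_k.
Proof. by move=> Hx; rewrite coef_fpoly; case: ifP => [/Hx//|_]; exact: homdeg0. Qed.

Lemma homdeg_coefM V d e (F G : {poly S}) : (forall k, homdeg V d F`_k) ->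
  (forall k, homdeg V e G`_k) -> forall k, homdeg V (d + e) (F * G)`_k.
Proof.
move=> HF HG k; rewrite coefM; apply: homdeg_sum => i _ _.
exact: homdegM.
Qed.

Lemma proj_pow_low V (F : {poly S}) d e a u : (forall k, homdeg V d F`_k) ->
  (content F ^ e)%ID u -> (a < d * e)%N -> proj V a u = 0.
Proof.
move=> HF; elim: e a u => [|e IH] a u; first by rewrite muln0.
have HK f : is_ideal [set u : S | forall a, (a < f)%N -> proj V a u = 0].
  apply: (graded_ideal (V := V) (Q := fun a => [set u | (a < f)%N -> u = 0])) => /=.
  - by [].
  - by move=> b p q Hp Hq bf; rewrite Hp ?Hq ?addr0.
  - by move=> b c m p Hp bf; rewrite Hp ?mulr0 //; lia.
move=> Hu; move: a; apply: (ideal_mul_min (HK _) _ Hu) => {u Hu} p q Hp Hq.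
have HK' : is_ideal [set p : S | forall a, (a < d * e.+1)%N -> proj V a (p * q) = 0].
  case: (HK (d * e.+1)%N) => K0 KD KM; split=> /= [|v w Hv Hw|r v Hv].
  - by rewrite mul0r.
  - by rewrite mulrDl; apply: KD.
  - by rewrite -mulrA; apply: KM.
apply: (content_min HK' _ Hp) => k /= a Ha.
rewrite (projM_homdeg _ _ (HF k)); case: leqP => // da.
by rewrite IH ?mulr0 //; lia.
Qed.

Lemma proj_content_low V (F : {poly S}) d a u : (forall k, homdeg V d F`_k) ->
  content F u -> (a < d)%N -> proj V a u = 0.
Proof.
by move=> HF /ideal_pow1 Hu Ha; apply: (proj_pow_low HF Hu); rewrite muln1.
Qed.

(* If F does not involve the variables in V, an element of c(F)^e that is
   homogeneous of V-degree a has all its coefficients divisible by degree-a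
   monomials in V. *)
Lemma proj_pow_free V (F : {poly S}) (J : set S) e a u : is_ideal J ->
  (forall k, V k -> J 'X_k) -> (forall k, homdeg V 0 F`_k) ->
  (content F ^ e)%ID u -> ideal_mul (content F ^ e)%ID (J ^ a)%ID (proj V a u).
Proof.
move=> HJ JX HF.
have Jm m : (J ^ deg V m)%ID 'X_[m].
  rewrite mpolyXE_id /deg (big_mkcond V).
  apply: (big_rec2 (fun d p => (J ^ d)%ID p)) => // k d p _ Hp.
  apply: ideal_powD => //; case: ifP => Vk //.
  by apply: ideal_powX; apply: JX.
set I := fun e a => ideal_mul (content F ^ e)%ID (J ^ a)%ID.
have HI e' a' : is_ideal (I e' a') by exact: is_ideal_mul.
have IM e' b c m v : I e' b v -> I e' (deg V m + b)%N (c *: 'X_[m] * v).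
  move=> Hv; have HK : is_ideal [set v | I e' (deg V m + b)%N (c *: 'X_[m] * v)].
    case: (HI e' (deg V m + b)%N) => K0 KD KM; split=> /= [|p q|r p].
    - by rewrite mulr0.
    - by rewrite mulrDr; apply: KD.
    - by rewrite mulrCA; apply: KM.
  apply: (ideal_mul_min HK _ Hv) => p q Hp Hq /=; rewrite mulrCA.
  apply: ideal_mulP => //; apply: ideal_powD => //.
  by case: (is_ideal_pow J (deg V m)) => _ _ KM; rewrite -mul_mpolyC; apply: KM.
have IG e' : is_ideal [set u | forall a, I e' a (proj V a u)].
  apply: (graded_ideal (V := V) (Q := I e')) => //.
  - by move=> b; case: (HI e' b).
  - by move=> b p q; case: (HI e' b) => _ D _; apply: D.
  - by move=> b c m p; apply: IM.
suff: (content F ^ e)%ID `<=` [set u | forall a, I e a (proj V a u)] by move=> H Hu; have /= := H u Hu; apply.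
elim: e {a u} => [|e IH].
  move=> u _; case: (IG 0%N) => _ _ GM.
  rewrite -[u]mulr1; apply: GM => a; rewrite (proj_homdeg (d := 0) _); last first.
    by rewrite -mpolyC1; apply: homdegC.
  case: eqP => [->|_]; last by case: (HI 0%N a).
  by rewrite -[1]mulr1; apply: ideal_mulP.
apply: (ideal_mul_min (IG e.+1)) => p q Hp Hq.
have HK' : is_ideal [set p | forall a, I e.+1 a (proj V a (p * q))].
  case: (IG e.+1) => K0 KD KM; split=> /= [|v w Hv Hw|r v Hv].
  - by rewrite mul0r.
  - by rewrite mulrDl; apply: KD.
  - by rewrite -mulrA; apply: KM.
apply: (content_min HK' _ Hp) => k /= a; rewrite projM0 //.
have Hqa := IH q Hq a.
have HK : is_ideal [set v | I e.+1 a (F`_k * v)].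
  case: (HI e.+1 a) => K0 KD KM; split=> /= [|v w|r v].
  - by rewrite mulr0.
  - by rewrite mulrDr; apply: KD.
  - by rewrite mulrCA; apply: KM.
apply: (ideal_mul_min HK _ Hqa) => v w Hv Hw /=; rewrite mulrA.
by apply: ideal_mulP => //; apply: ideal_powS => //; apply: content_coef.
Qed.

Lemma homdeg_fpoly (v : nat -> 'I_n) M k :
  homdeg (vars v M) 1 (fpoly (pvar R v) M)`_k.
Proof.
apply: homdeg_coef => i iM; have := @homdegX R n (vars v M) (v i).
by rewrite (vars_in _ iM).
Qed.

Lemma homdeg_fpoly_disj (v w : nat -> 'I_n) M N k : disj_lt v M w N ->
  homdeg (vars v M) 0 (fpoly (pvar R w) N)`_k.
Proof.
move=> disj; apply: homdeg_coef => i iN; have := @homdegX R n (vars v M) (w i).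
by rewrite (negbTE (disj_vars (disj_ltC disj) (vars_in _ iN))).
Qed.

End HomogeneousContent.

Section Two.
Variables (R : idomainType) (n : nat) (vx vy : nat -> 'I_n) (M N : nat).
Hypotheses (injx : inj_lt vx M) (injy : inj_lt vy N) (disj : disj_lt vx M vy N).
Local Notation S := {mpoly R[n]}.
Local Notation x := (@pvar R n vx).
Local Notation y := (@pvar R n vy).
Local Notation X := (vars vx M).
Local Notation Y := (vars vy N).
Local Notation e0 := (kill R (vxy vx vy M N)).
Local Notation lift := (lift_xy R vx vy M N).
Local Notation tau := (tau R n M N).
Local Notation ev := (ev_xy R vx vy M N).
Local Notation ext := (extension x y M N lift e0 tau ev).
Local Notation f := (fpoly x M).
Local Notation g := (fpoly y N).

Let gp := @generic_pair_xy R n vx vy M N injx injy disj.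

Let Xf := @homdeg_fpoly R n vx M.
Let Yf k := @homdeg_fpoly_disj R n vy vx N M k (disj_ltC disj).
Let Xg k := @homdeg_fpoly_disj R n vx vy M N k disj.
Let Yg := @homdeg_fpoly R n vy N.

Lemma is_ideal_extension (I : set {mpoly R[(M + N).+1 + n]}) :
  is_ideal [set u : S | forall a b, ext I a b (proj X a (proj Y b u))].
Proof.
apply: (bigraded_ideal (V := X) (W := Y) (Q := fun a b => ext I a b)).
- by move=> *; exact: extension0.
- by move=> *; exact: extensionD.
- move=> a b c m u Hu; apply: extensionMl => //.
  apply: bih_homdeg => // k; move/msuppZ_le; rewrite msuppX inE => /eqP -> //.
Qed.

Lemma content_fg_extension (I : set {mpoly R[(M + N).+1 + n]}) a b u :
  (forall k, (k < (M + N).-1)%N -> I (tau k)) -> content (f * g) u ->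
  ext I a b (proj X a (proj Y b u)).
Proof.
move=> It Hu; move: a b; apply: (content_min (is_ideal_extension I) _ Hu) => k a b.
have [kMN|kMN] := ltnP k (M + N).-1; last first.
  rewrite coef_fpolyM pcoef_large // !proj0; exact: extension0.
rewrite (proj_homdeg _ (homdeg_coefM Yf Yg (k := k))).
case: ifP => [/eqP ->|_]; last by rewrite proj0; apply: extension0.
rewrite (proj_homdeg _ (homdeg_coefM Xf Xg (k := k))).
case: ifP => [/eqP ->|_]; last by apply: extension0.
have H1 : bihS x y M N e0 0 0 0 0 1 by apply: bihomC; apply: range1.
have tk : homL M N lift tau 0 1 (tau k) by apply: homL_tau; lia.
have := extensionM ev (It k kMN) tk H1.
by rewrite mulr1 (ev_tau gp) ?coef_fpolyM //; lia.
Qed.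

(** If a >= N or b >= M, every form of bidegree (a, b) lies in the ideal. Otherwise (a, b) is in the
    range of freeness, the two pure powers have no component there, and the ideal is the extension
    of the one generated by the [tau k], modulo which only K remains. *)
Lemma L2_torsion_free c u : e0 c != 0 -> L2 x M y N (e0 c * u) -> L2 x M y N u.
Proof.
move=> c0 Lcu; have HL := is_ideal_L2 x M y N; case: (HL) => L0 LD _.
have HX0 : homdeg X 0 (e0 c) by apply: homdeg_kill => k Xk; rewrite /= /vxy Xk.
have HY0 : homdeg Y 0 (e0 c) by apply: homdeg_kill => k Yk; rewrite /= /vxy Yk orbT.
apply: (proj_ind (V := Y)) => // b; apply: (proj_ind (V := X)) => // a.
have Hv := bih_proj disj a b u.
set v := proj X a (proj Y b u) in Hv *.
have [fa gb] := bih_pow Hv.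
have [Na|aN] := leqP N a; first by apply: L2_f; apply: ideal_pow_le fa.
have [Mb|bM] := leqP M b; first by apply: L2_g; apply: ideal_pow_le gb.
pose I := ideal_gen [set tau k | k in [set k | (k < (M + N).-1)%N]].
have It k : (k < (M + N).-1)%N -> I (tau k).
  by move=> kMN; apply: sub_ideal_gen; exists k.
have HI : is_ideal I by exact: is_ideal_gen.
have extv : ext I a b (e0 c * v).
  rewrite /v -projM0 // -projM0 //.
  case: Lcu => [_ [s1 Hs1 [s2 Hs2 <-]] [s3 Hs3 <-]].
  rewrite !projD (projC X Y a b s2).
  rewrite (proj_pow_low Xf Hs2) ?mul1n // proj0 addr0.
  rewrite (proj_pow_low Yg Hs3) ?mul1n // proj0 addr0.
  exact: content_fg_extension.
have {extv} : ext I a b v.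
  apply: (flat_descent gp (I := I) HI _ _ _ Hv extv); [lia|lia|].
  move=> [|e] w Hw Icw.
    have [d _ wE] := bihomC_inv (range0 lift) (@rangeD _ _ lift) Hw.
    (* The tails from M and N are empty, so [ev M N] sends every [tau k] in question to 0 and thus
       vanishes on [I]; on constants it is [e0]. Hence [I] contains no nonzero constant of K. *)
    have HK := ideal_map (ev M N) (J := [set 0]) _.
    have /HK{}HK : is_ideal [set (0 : S)].
      by split=> [//|_ _ -> ->|r _ ->]; rewrite ?addr0 ?mulr0.
    have : [set w | [set 0] (ev M N w)] (lift c * w).
      apply: (ideal_gen_min HK _ Icw) => _ /= [k Hk <-].
      rewrite (ev_tau gp) /=; last by lia.
      by rewrite /pcoef big_geq.
    rewrite /= -wE rmorphM !(ev_kap gp) => /eqP; rewrite mulf_eq0 (negbTE c0) /= => /eqP d0.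
    by rewrite -(kap_e0 gp) (d0 : e0 d = 0) rmorph0; case: HI.
  rewrite /homL /bih in Hw; remember e.+1 as e' eqn:ee.
  elim: Hw e ee => // {e' w Icw} [a' b' e _|a' b' p q _ IHp _ IHq e ee|z a' b' p [k Hk ->] _ _ e _|z a' b' p [k Hk _]] //.
  - by case: HI.
  - by case: HI => _ ID _; apply: ID; [apply: IHp ee|apply: IHq ee].
  - by apply: (is_idealMr HI); apply: It; lia.
apply: extension_sub => // l Il; have HK := ideal_map (ev 0 0)%N HL.
apply: (ideal_gen_min HK _ Il) => _ /= [k Hk <-].
rewrite (ev_tau gp) /=; last by lia.
by apply: L2_fg; rewrite -coef_fpolyM; apply: content_coef.
Qed.

End Two.

(** * The ideals L(f, g, h) *)

Section L3.
Variable A : comNzRingType.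
Implicit Types (x y z : nat -> A) (K : set A).

Definition L3 x M y N z P : set A :=
  (content (fpoly x M * fpoly y N * fpoly z P)
   + content (fpoly x M * fpoly y N) ^ P
   + content (fpoly x M * fpoly z P) ^ N
   + content (fpoly y N * fpoly z P) ^ M
   + content (fpoly x M) ^ (N + P).-1
   + content (fpoly y N) ^ (M + P).-1
   + content (fpoly z P) ^ (M + N).-1)%ID.

Lemma is_ideal_L3 x M y N z P : is_ideal (L3 x M y N z P).
Proof.
do 6!(apply: is_ideal_add; last exact: is_ideal_pow).
exact: is_ideal_content.
Qed.

Lemma L3_min x M y N z P K : is_ideal K ->
  content (fpoly x M * fpoly y N * fpoly z P) `<=` K ->
  (content (fpoly x M * fpoly y N) ^ P)%ID `<=` K ->
  (content (fpoly x M * fpoly z P) ^ N)%ID `<=` K ->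
  (content (fpoly y N * fpoly z P) ^ M)%ID `<=` K ->
  (content (fpoly x M) ^ (N + P).-1)%ID `<=` K ->
  (content (fpoly y N) ^ (M + P).-1)%ID `<=` K ->
  (content (fpoly z P) ^ (M + N).-1)%ID `<=` K -> L3 x M y N z P `<=` K.
Proof. by move=> HK *; do 6!apply: ideal_add_min => //. Qed.

Lemma L3_fgh x M y N z P : content (fpoly x M * fpoly y N * fpoly z P) `<=` L3 x M y N z P.
Proof.
by move=> u Hu; do 6!(apply: ideal_addl; first exact: is_ideal_pow).
Qed.

Lemma L3_fg x M y N z P : (content (fpoly x M * fpoly y N) ^ P)%ID `<=` L3 x M y N z P.
Proof.
move=> u Hu; do 5!(apply: ideal_addl; first exact: is_ideal_pow).
apply: ideal_addr Hu.
exact: is_ideal_content.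
Qed.

Lemma L3_fh x M y N z P : (content (fpoly x M * fpoly z P) ^ N)%ID `<=` L3 x M y N z P.
Proof.
move=> u Hu; do 4!(apply: ideal_addl; first exact: is_ideal_pow).
apply: ideal_addr Hu; do 1!(apply: is_ideal_add; last exact: is_ideal_pow).
exact: is_ideal_content.
Qed.

Lemma L3_gh x M y N z P : (content (fpoly y N * fpoly z P) ^ M)%ID `<=` L3 x M y N z P.
Proof.
move=> u Hu; do 3!(apply: ideal_addl; first exact: is_ideal_pow).
apply: ideal_addr Hu; do 2!(apply: is_ideal_add; last exact: is_ideal_pow).
exact: is_ideal_content.
Qed.

Lemma L3_f x M y N z P : (content (fpoly x M) ^ (N + P).-1)%ID `<=` L3 x M y N z P.
Proof.
move=> u Hu; do 2!(apply: ideal_addl; first exact: is_ideal_pow).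
apply: ideal_addr Hu; do 3!(apply: is_ideal_add; last exact: is_ideal_pow).
exact: is_ideal_content.
Qed.

Lemma L3_g x M y N z P : (content (fpoly y N) ^ (M + P).-1)%ID `<=` L3 x M y N z P.
Proof.
move=> u Hu; do 1!(apply: ideal_addl; first exact: is_ideal_pow).
apply: ideal_addr Hu; do 4!(apply: is_ideal_add; last exact: is_ideal_pow).
exact: is_ideal_content.
Qed.

Lemma L3_h x M y N z P : (content (fpoly z P) ^ (M + N).-1)%ID `<=` L3 x M y N z P.
Proof.
move=> u Hu.
apply: ideal_addr Hu; do 5!(apply: is_ideal_add; last exact: is_ideal_pow).
exact: is_ideal_content.
Qed.

Lemma L3_swap x M y N z P : L3 x M y N z P `<=` L3 x M z P y N.
Proof.
apply: L3_min; first exact: is_ideal_L3.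
- by rewrite mulrAC; apply: L3_fgh.
- exact: L3_fh.
- exact: L3_fg.
- by rewrite mulrC; apply: L3_gh.
- by rewrite addnC; apply: L3_f.
- exact: L3_h.
- exact: L3_g.
Qed.

Lemma L3_rot x M y N z P : L3 x M y N z P `<=` L3 y N z P x M.
Proof.
apply: L3_min; first exact: is_ideal_L3.
- by rewrite -mulrA mulrC; apply: L3_fgh.
- by rewrite mulrC; apply: L3_fh.
- by rewrite mulrC; apply: L3_gh.
- exact: L3_fg.
- exact: L3_h.
- by rewrite addnC; apply: L3_f.
- by rewrite addnC; apply: L3_g.
Qed.

End L3.

(** * Products of contents absorbed by Dedekind-Mertens *)

Section Cross.
Variables (R : idomainType) (n : nat).
Local Notation S := {mpoly R[n]}.
Implicit Types (V : pred 'I_n) (w y : nat -> S).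

Lemma ideal_mul_pow1 (I J : set S) e : is_ideal J -> (0 < e)%N ->
  ideal_mul I (J ^ e)%ID `<=` ideal_mul I J.
Proof.
move=> HJ e0; apply: ideal_mul_min; first exact: is_ideal_mul.
move=> a b Ia Hb; apply: ideal_mulP => //.
have /(ideal_pow_le e0) : (J ^ e)%ID b by [].
by apply: ideal_mul_min => // c d Jc _; apply: is_idealMr.
Qed.

(** Positive V-degree supplies a factor from the content of the second polynomial, and the N-th
    power present suffices to absorb it. *)
Lemma content_cross V w K (v : nat -> 'I_n) N b u :
  (forall k, homdeg V 0 (fpoly w K)`_k) -> (forall k, V k -> vars v N k) ->
  (content (fpoly w K) ^ N)%ID u -> (0 < b)%N ->
  content (fpoly w K * fpoly (@pvar R n v) N) (proj V b u).
Proof.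
move=> Hw HV Hu b0; set G := fpoly _ N.
have HG : is_ideal (content G) by exact: is_ideal_content.
have GX k : V k -> content G 'X_k.
  by move=> /HV/varsP[i iN <-]; apply: content_fpoly_var.
have := proj_pow_free (a := b) HG GX Hw Hu; move/(ideal_mul_pow1 HG b0).
apply: ideal_mul_min; first exact: is_ideal_content.
by move=> p q; apply: Dedekind_Mertens_content.
Qed.

(** Now the large power comes from the V-degree: the component lies in c(w) c(v)^a, and a >= K meets
    the exponent. *)
Lemma content_cross_high V w K (v : nat -> 'I_n) M a u :
  (forall k, homdeg V 0 (fpoly w K)`_k) -> (forall k, V k -> vars v M k) ->
  content (fpoly w K) u -> (K <= a)%N ->
  content (fpoly (@pvar R n v) M * fpoly w K) (proj V a u).
Proof.
move=> Hw HV /ideal_pow1 Hu Ka; set G := fpoly _ M.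
have HG : is_ideal (content G) by exact: is_ideal_content.
have GX k : V k -> content G 'X_k.
  by move=> /HV/varsP[i iN <-]; apply: content_fpoly_var.
have := proj_pow_free (a := a) HG GX Hw Hu; apply: ideal_mul_min.
  exact: is_ideal_content.
move=> p q; have HF : is_ideal (content (fpoly w K)) by exact: is_ideal_content.
move=> Hp /(ideal_pow_le Ka) Hq; rewrite [p * q]mulrC.
apply: Dedekind_Mertens_content => //.
by apply: (ideal_mul_min HF _ Hp) => c d Hc _; apply: (is_idealMr HF).
Qed.

End Cross.

Section ExtensionPowers.
Variables (R : idomainType) (n : nat) (vx vy : nat -> 'I_n) (M N : nat).
Hypotheses (injx : inj_lt vx M) (injy : inj_lt vy N) (disj : disj_lt vx M vy N).
Local Notation S := {mpoly R[n]}.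
Local Notation Lam := {mpoly R[(M + N).+1 + n]}.
Local Notation x := (@pvar R n vx).
Local Notation y := (@pvar R n vy).
Local Notation X := (vars vx M).
Local Notation Y := (vars vy N).
Local Notation e0 := (kill R (vxy vx vy M N)).
Local Notation lift := (lift_xy R vx vy M N).
Local Notation tau := (tau R n M N).
Local Notation ev := (ev_xy R vx vy M N).
Local Notation ext := (extension x y M N lift e0 tau ev).
Local Notation homL := (homL M N lift tau 0).
Local Notation bihxy := (bihS x y M N e0 0 0).

Let gp := @generic_pair_xy R n vx vy M N injx injy disj.

Lemma extension_setT a b u : bihxy a b u -> ext setT a b u.
Proof.
move=> Hu; have h1 : homL 0 1 by rewrite -(rmorph1 lift); apply: homL_kap.
have := extensionM ev (I := setT) (l := 1) Logic.I h1 Hu.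
by rewrite rmorph1 mul1r.
Qed.

Lemma content_pow_extension (G : {poly S}) d (l : nat -> Lam) (J : set Lam) e a b u :
  (forall k, ev 0 0 (l k) = G`_k) -> (forall k, homL d (l k)) -> (forall k, J (l k)) ->
  (forall k, homdeg X d G`_k) -> (forall k, homdeg Y d G`_k) ->
  (content G ^ e)%ID u -> ext (J ^ e)%ID a b (proj X a (proj Y b u)).
Proof.
move=> evl hl Jl hX hY.
elim: e a b u => [|e IH] a b u Hu; first by apply: extension_setT; apply: bih_proj.
move: a b; have HK := is_ideal_extension disj (J ^ e.+1)%ID.
apply: (ideal_mul_min HK _ Hu) => {u Hu} p q Hp Hq.
have HK' : is_ideal [set p : S | forall a b,
    ext (J ^ e.+1)%ID a b (proj X a (proj Y b (p * q)))].
  case: HK => K0 KD KM; split=> /= [|v w Hv Hw|r v Hv].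
  - by rewrite mul0r.
  - by rewrite mulrDl; apply: KD.
  - by rewrite -mulrA; apply: KM.
apply: (content_min HK' _ Hp) => k /= a b.
rewrite (projM_homdeg _ _ (hY k)); case: leqP => db; last first.
  by rewrite proj0; apply: extension0.
rewrite (projM_homdeg _ _ (hX k)); case: leqP => da; last exact: extension0.
have b1 : bihxy 0 0 1 by apply: bihomC; apply: range1.
have E1 := extensionM ev (Jl k) (hl k) b1.
have := extension_mul E1 (IH (a - d) (b - d) q Hq)%N.
by rewrite mulr1 evl !addn0 !subnKC.
Qed.

(** Each application extracts one coefficient of [f g] and lowers both degrees by one. The last of
    the e applications still needs x-degree N, or y-degree M, whence the bounds. *)
Lemma Dedekind_Mertens_extension (J : set Lam) e a b u :
  (forall k, (k < (M + N).-1)%N -> J (tau k)) ->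
  (e <= a)%N -> (e <= b)%N -> (N.-1 + e <= a)%N || (M.-1 + e <= b)%N ->
  bihxy a b u -> ext (J ^ e)%ID a b u.
Proof.
move=> Jt; elim: e a b u => [|e IH] a b u ea eb H Hu; first exact: extension_setT.
case: a ea H Hu => // a ea H Hu; case: b eb H Hu => // b eb H Hu.
have [v Hv ->] : pspan (range e0) x y M N 0 0 a b u.
  have DM := Dedekind_Mertens (range1 e0) (@rangeM _ _ e0) (@rangeN _ _ e0).
  have [H1|H1] := boolP (N - 0 <= a.+1)%N; first exact: (DM _ _ _ _ _ _ _ _ _ H1 Hu).
  have H2 : (M - 0 <= b.+1)%N by lia.
  have [v Hv ->] := DM _ _ _ _ _ _ _ _ _ H2 (bih_swap Hu).
  exists v; first by move=> k; apply: bih_swap; exact: Hv.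
  by rewrite addnC; apply: eq_bigr => k _; rewrite pcoef_swap.
apply: extension_sum => k _.
have [kMN|kMN] := ltnP k (M + N).-1; last first.
  by rewrite pcoef_large // mul0r; apply: extension0.
have b1 : bihxy 0 0 1 by apply: bihomC; apply: range1.
have tk : homL 1 (tau k) by apply: homL_tau; lia.
have E1 := extensionM ev (Jt k kMN) tk b1.
have E2 : ext (J ^ e)%ID a b (v k) by apply: IH; [lia|lia|lia|exact: Hv].
have := extension_mul E1 E2; rewrite mulr1 addn0 !add1n (ev_tau gp) //; lia.
Qed.

End ExtensionPowers.

(** Symmetric in the three families, so that each argument is written for one ordering only. By
    [tri_cover], setting all three families to 0 leaves just the constants of R. *)
Record triple n (vx : nat -> 'I_n) M (vy : nat -> 'I_n) N (vz : nat -> 'I_n) P :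
    Prop := Triple {
  tri_injx : inj_lt vx M;
  tri_injy : inj_lt vy N;
  tri_injz : inj_lt vz P;
  tri_xy : disj_lt vx M vy N;
  tri_xz : disj_lt vx M vz P;
  tri_yz : disj_lt vy N vz P;
  tri_pos : [/\ (0 < M)%N, (0 < N)%N & (0 < P)%N];
  tri_cover : forall k, [|| vars vx M k, vars vy N k | vars vz P k] }.

Lemma triple_swap n (vx : nat -> 'I_n) M vy N vz P :
  triple vx M vy N vz P -> triple vx M vz P vy N.
Proof.
case=> ? ? ? ? ? ? [? ? ?] ?; split=> // [|k]; first exact: disj_ltC.
by rewrite [vars vz P k || _]orbC.
Qed.

Lemma triple_rot n (vx : nat -> 'I_n) M vy N vz P :
  triple vx M vy N vz P -> triple vy N vz P vx M.
Proof.
case=> ? ? ? ? ? ? [? ? ?] ?; split=> // [||k]; try exact: disj_ltC.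
by rewrite orbA orbC.
Qed.

(** * Torsion-freeness modulo L(f, g, h) in the range of freeness *)

Section Triple.
Variables (R : idomainType) (n : nat) (vx vy vz : nat -> 'I_n) (M N P : nat).
Hypothesis tri : triple vx M vy N vz P.
Local Notation S := {mpoly R[n]}.
Local Notation Lam := {mpoly R[(M + N).+1 + n]}.
Local Notation x := (@pvar R n vx).
Local Notation y := (@pvar R n vy).
Local Notation z := (@pvar R n vz).
Local Notation X := (vars vx M).
Local Notation Y := (vars vy N).
Local Notation Z := (vars vz P).
Local Notation f := (fpoly x M).
Local Notation g := (fpoly y N).
Local Notation h := (fpoly z P).
Local Notation e0 := (kill R (vxy vx vy M N)).
Local Notation lift := (lift_xy R vx vy M N).
Local Notation tau := (tau R n M N).
Local Notation ev := (ev_xy R vx vy M N).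
Local Notation ext := (extension x y M N lift e0 tau ev).
Local Notation homL := (homL M N lift tau 0).

Let injx := tri_injx tri.
Let injy := tri_injy tri.
Let injz := tri_injz tri.
Let disj := tri_xy tri.
Let gp := @generic_pair_xy R n vx vy M N injx injy disj.

Let Xf := @homdeg_fpoly R n vx M.
Let Yf k := @homdeg_fpoly_disj R n vy vx N M k (disj_ltC disj).
Let Xg k := @homdeg_fpoly_disj R n vx vy M N k disj.
Let Yg := @homdeg_fpoly R n vy N.
Let Xh k := @homdeg_fpoly_disj R n vx vz M P k (tri_xz tri).
Let Yh k := @homdeg_fpoly_disj R n vy vz N P k (tri_yz tri).

Let vt (k : nat) : 'I_((M + N).+1 + n) := lshift n (inord k).
Let vz' (k : nat) : 'I_((M + N).+1 + n) := rshift (M + N).+1 (vz k).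
Let z' := pvar R vz'.

Let notXY i : (i < P)%N -> vxy vx vy M N (vz i) = false.
Proof.
move=> iP; rewrite /vxy.
rewrite (negbTE (disj_vars (disj_ltC (tri_xz tri)) (vars_in _ iP))).
by rewrite (negbTE (disj_vars (disj_ltC (tri_yz tri)) (vars_in _ iP))).
Qed.

Let z'E i : (i < P)%N -> z' i = lift (z i).
Proof. by move=> iP; rewrite substX notXY. Qed.

Let ev_z' i : (i < P)%N -> ev 0 0 (z' i) = z i.
Proof. by move=> iP; rewrite z'E // (ev_kap gp) substX notXY. Qed.

Let F : {poly Lam} := fpoly tau (M + N).-1.
Let H : {poly Lam} := fpoly z' P.

Let evF : map_poly (ev 0 0)%N F = f * g.
Proof.
rewrite map_fpoly fpolyM; apply: eq_fpoly => k kMN /=.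
by rewrite (ev_tau gp) //; lia.
Qed.

Let evH : map_poly (ev 0 0)%N H = h.
Proof. by rewrite map_fpoly; apply: eq_fpoly => k kP /=; rewrite ev_z'. Qed.

Let homF k : homL 1 F`_k.
Proof.
rewrite coef_fpoly; case: ifP => kMN; last exact: homL0.
by apply: homL_tau; lia.
Qed.

Let homH k : homL 0 H`_k.
Proof.
rewrite coef_fpoly; case: ifP => kP; last exact: homL0.
by rewrite z'E //; apply: homL_kap.
Qed.

Let homFH k : homL 1 (F * H)`_k.
Proof.
rewrite coefM; apply: bihom_sum => i _.
by have := homLM (homF i) (homH (k - i)); rewrite addn0.
Qed.

Let I := L2 tau (M + N).-1 z' P.

(** The [tau k] are themselves variables of [Lam], so [I] is again the ideal of two generic
    polynomials and its torsion-freeness is already known. *)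
Let IE : I = L2 (pvar R vt) (M + N).-1 (pvar R vz') P.
Proof. by []. Qed.

(** The three summands of L(F, h) specialize into c(f g h), c(f g)^P and c(h)^(M + N - 1). *)
Let I_ev_L3 l : I l -> L3 x M y N z P (ev 0 0 l).
Proof.
have HL := is_ideal_L3 x M y N z P; have HK := ideal_map (ev 0 0)%N HL.
apply: (L2_min HK) => u Hu /=.
- by apply: L3_fgh; rewrite -evF -evH -rmorphM; apply: content_map.
- apply: L3_fg; apply: pow_map Hu => w; rewrite -evF; exact: content_map.
- apply: L3_h; apply: pow_map Hu => w; rewrite -[h]evH; exact: content_map.
Qed.

Let fgh_ext a b u : content (f * g * h) u -> ext I a b (proj X a (proj Y b u)).
Proof.
move=> /ideal_pow1 Hu.
have Xfgh := homdeg_coefM (homdeg_coefM Xf Xg) Xh.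
have Yfgh := homdeg_coefM (homdeg_coefM Yf Yg) Yh.
have HFH : is_ideal (content (F * H)) by exact: is_ideal_content.
apply: (sub_extension (I := (content (F * H) ^ 1)%ID)).
  apply: ideal_mul_min; first exact: is_ideal_L2.
  by move=> c d Hc _; apply: L2_fg; apply: (is_idealMr HFH).
apply: (content_pow_extension (d := 1) disj (l := fun k => (F * H)`_k)) Hu => //.
- by move=> k; rewrite -evF -[h]evH -rmorphM coef_map.
- exact: content_coef.
Qed.

(* In the range where S is free over Lam, L(f, g, h) is the extension of
   L(F, h), where F is the generic polynomial specializing to f g. *)
Let L3_extension a b u : (b < a + M)%N -> (a < b + N)%N ->
  L3 x M y N z P u -> ext I a b (proj X a (proj Y b u)).
Proof.
move=> ba ab; case=> _ [_ [_ [_ [_ [s1 Hs1 [s2 Hs2 <-]] [s3 Hs3 <-]] [s4 Hs4 <-]]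
  [s5 Hs5 <-]] [s6 Hs6 <-]] [s7 Hs7 <-].
have [M0 N0 P0] := tri_pos tri; rewrite !projD; do ?apply: extensionD.
- exact: fgh_ext.
- apply: (sub_extension (I := (content F ^ P)%ID)); first exact: L2_f.
  apply: (content_pow_extension (d := 1) disj (l := fun k => F`_k)) Hs2 => //.
  + by move=> k; rewrite -evF coef_map.
  + exact: content_coef.
  + exact: (homdeg_coefM Xf Xg).
  + exact: (homdeg_coefM Yf Yg).
(* For b = 0 the range gives a < N, below every degree occurring in c(f h)^N; for b > 0 the
   component already lies in c(f g h). The summand c(g h)^M is treated in the same way with a. *)
- have [b0|b0] := posnP b.
    rewrite projC (proj_pow_low (homdeg_coefM Xf Xh) Hs3) ?proj0; last by lia.
    exact: extension0.
  rewrite -[proj Y b s3]proj_id; apply: fgh_ext.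
  have Yfh := homdeg_coefM Yf Yh.
  move: Hs3 Yfh; rewrite mulrAC fpolyM => Hs3 Yfh.
  exact: (content_cross Yfh).
- have [a0|a0] := posnP a.
    rewrite (proj_pow_low (homdeg_coefM Yg Yh) Hs4) ?proj0; last by lia.
    exact: extension0.
  rewrite projC -[proj X a s4]proj_id projC; apply: fgh_ext.
  have Xgh := homdeg_coefM Xg Xh.
  move: Hs4 Xgh; rewrite -mulrA [f * _]mulrC fpolyM => Hs4 Xgh.
  exact: (content_cross Xgh).
(* If a >= N + P - 1, the range forces b >= P, and the degrees suffice to extract P coefficients of
   [f g]. The summand from [g] is symmetric. *)
- have [a0|a0] := ltnP a (N + P).-1.
    rewrite projC (proj_pow_low Xf Hs5) ?mul1n // proj0.
    exact: extension0.
  apply: (sub_extension (I := (content F ^ P)%ID)); first exact: L2_f.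
  apply: Dedekind_Mertens_extension => //; try lia; last exact: bih_proj.
  by move=> k; apply: content_fpoly_var.
- have [b0|b0] := ltnP b (M + P).-1.
    rewrite (proj_pow_low Yg Hs6) ?mul1n // proj0.
    exact: extension0.
  apply: (sub_extension (I := (content F ^ P)%ID)); first exact: L2_f.
  apply: Dedekind_Mertens_extension => //; try lia; last exact: bih_proj.
  by move=> k; apply: content_fpoly_var.
- apply: (sub_extension (I := (content H ^ (M + N).-1)%ID)); first exact: L2_g.
  apply: (content_pow_extension (d := 0) disj (l := fun k => H`_k)) Hs7 => //.
  + by move=> k; rewrite -[h]evH coef_map.
  + exact: content_coef.
Qed.

Lemma L3_torsion_free_range (r : R) a b u :
  r != 0 -> (b < a + M)%N -> (a < b + N)%N ->
  L3 x M y N z P (r%:MP * u) -> L3 x M y N z P (proj X a (proj Y b u)).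
Proof.
move=> r0 ba ab Lru.
have e0r : e0 r%:MP = r%:MP by rewrite substC.
have extv : ext I a b (e0 r%:MP * proj X a (proj Y b u)).
  rewrite e0r -!projM0; first exact: L3_extension.
  - exact: homdegC.
  - exact: homdegC.
apply: (@extension_sub _ _ _ _ _ _ _ _ _ _ _ _ _ _ _ (is_ideal_L3 x M y N z P) I_ev_L3).
apply: (flat_descent gp (is_ideal_L2 _ _ _ _) ba ab _ (bih_proj disj a b u) extv).
move=> e w _; rewrite -/I IE substC => Lw.
apply: (L2_torsion_free (c := r%:MP) _ _ _ _); last by rewrite substC; exact: Lw.
- move=> i j iMN jMN /(congr1 val) /=; rewrite !inordK //; lia.
- by move=> i j iP jP /(@rshift_inj _ _ _ _) /injz; apply.
- by move=> i j iMN jP /eqP; rewrite eq_lrshift.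
- by rewrite substC mpolyC_eq0.
Qed.

End Triple.

(** * The primary decomposition *)

Section Primary.
Variable S : comNzRingType.
Implicit Types (L : set S) (e : {rmorphism S -> S}).

Lemma is_ideal_radical L : is_ideal L -> is_ideal [set u | exists k, L (u ^+ k)].
Proof.
move=> HL; case: (HL) => L0 LD LM; split=> /=.
- by exists 1%N; rewrite expr1.
- move=> u v [k Lu] [l Lv]; exists (k + l)%N; rewrite exprDn.
  apply: (is_ideal_sum HL) => i _; rewrite -mulr_natl; apply: (LM).
  have [li|il] := leqP l i.
    by rewrite -(subnKC li) exprD; apply: LM; apply: (is_idealMr HL).
  have ki : (k <= k + l - i)%N by lia.
  by rewrite -(subnKC ki) exprD; apply: (is_idealMr HL); apply: (is_idealMr HL).
- by move=> r u [k Lu]; exists k; rewrite exprMn; apply: LM.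
Qed.

(** If e b = 0, some power of b is in L. Otherwise t = b - e b has some t^k in L, and b = e b + t
    divides (e b)^k - (-t)^k; so a b in L gives (e b)^k a in L, and torsion-freeness cancels the
    factors e b. *)
Lemma primary_torsion_free L e : is_ideal L -> (forall u, L u -> e u = 0) ->
  (forall u, e (e u) = e u) -> (forall u, e u = 0 -> exists k, L (u ^+ k)) ->
  (forall c u, e c != 0 -> L (e c * u) -> L u) -> primary_ideal L.
Proof.
move=> HL Le ee Lnil Ltf; case: (HL) => L0 LD LM; split=> // [L1|a b Lab].
  by have := Le _ L1; rewrite rmorph1 => /eqP; rewrite oner_eq0.
have [eb0|eb] := eqVneq (e b) 0; [by right; apply: Lnil|left].
have et : e (b - e b) = 0 by rewrite rmorphB ee subrr.
have [k Lt] := Lnil _ et.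
have : L (e b ^+ k * a).
  rewrite -[e b ^+ k](subrK ((- (b - e b)) ^+ k)) mulrDl; apply: (LD).
    rewrite subrXX opprK [e b + _]addrC subrK mulrAC [b * a]mulrC.
    exact: (is_idealMr HL).
  by rewrite exprNn -mulrA; apply: (LM); apply: (is_idealMr HL).
elim: k {Lt} => [|k IH]; first by rewrite expr0 mul1r.
by rewrite exprS -mulrA => /(Ltf _ _ eb).
Qed.

Lemma ideal_subD L e u v : is_ideal L -> L (u - e u) -> L (v - e v) ->
  L (u + v - e (u + v)).
Proof. by case=> _ LD _ Lu Lv; rewrite rmorphD opprD addrACA; apply: LD. Qed.

Lemma ideal_subM L e u v : is_ideal L -> L (u - e u) -> L (v - e v) ->
  L (u * v - e (u * v)).
Proof.
move=> HL; case: (HL) => _ LD LM Lu Lv.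
rewrite rmorphM -(subrKA (u * e v)) -mulrBr -mulrBl.
by apply: LD; [apply: LM|apply: (is_idealMr HL)].
Qed.

End Primary.

Section KillIdeal.
Variables (R : idomainType) (n : nat).
Local Notation S := {mpoly R[n]}.
Implicit Types (V : pred 'I_n) (K : set S).

Lemma mpoly_ring_ind (Q : S -> Prop) : (forall c, Q c%:MP) -> (forall k, Q 'X_k) ->
  (forall u v, Q u -> Q v -> Q (u + v)) -> (forall u v, Q u -> Q v -> Q (u * v)) ->
  forall u, Q u.
Proof.
move=> QC QX QD QM; apply: mpolyind => [|c m u _ _ Qu].
  by rewrite -mpolyC0; apply: QC.
apply: (QD) => //; rewrite -mul_mpolyC; apply: (QM); first exact: QC.
rewrite mpolyXE_id; apply: (big_ind Q) => [|v w|k _]; [|exact: QM|].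
  by rewrite -mpolyC1; apply: QC.
elim: (m k) => [|e IH]; first by rewrite expr0 -mpolyC1; apply: QC.
by rewrite exprS; apply: QM.
Qed.

Lemma kill_ideal V K u : is_ideal K -> (forall k, V k -> K 'X_k) ->
  K (u - kill R V u).
Proof.
move=> HK KX; elim/mpoly_ring_ind: u => [c|k|u v Hu Hv|u v Hu Hv].
- by rewrite substC subrr; case: HK.
- by rewrite substX; case: ifP => [/KX|_]; rewrite ?subr0 ?subrr; case: HK.
- exact: (@ideal_subD S K (kill R V) u v HK Hu Hv).
- exact: (@ideal_subM S K (kill R V) u v HK Hu Hv).
Qed.

Lemma kill_eq0_ideal V K u : is_ideal K -> (forall k, V k -> K 'X_k) ->
  kill R V u = 0 -> K u.
Proof. by move=> HK KX u0; have := kill_ideal u HK KX; rewrite (u0 : kill R V u = 0) subr0. Qed.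

Lemma is_ideal_kill V : is_ideal [set u : S | kill R V u = 0].
Proof.
have H0 : is_ideal [set 0 : S].
  by split=> [//|_ _ -> ->|r _ ->]; rewrite ?addr0 ?mulr0.
exact: (ideal_map (kill R V) H0).
Qed.

Lemma pow_content_kill V (v : nat -> 'I_n) M e u : subpred (vars v M) V ->
  (0 < e)%N -> (content (fpoly (pvar R v) M) ^ e)%ID u -> kill R V u = 0.
Proof.
move=> MV e0 /(ideal_pow_le e0) Hu; have HK := is_ideal_kill V.
apply: (ideal_mul_min HK _ Hu) => p q Hp _ /=.
apply: (is_idealMr HK); apply: (content_fpoly HK _ Hp) => i iM /=.
by rewrite substX MV // vars_in.
Qed.

Lemma content_kill V (v : nat -> 'I_n) M u : subpred (vars v M) V ->
  content (fpoly (pvar R v) M) u -> kill R V u = 0.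
Proof. by move=> MV /ideal_pow1; apply: pow_content_kill. Qed.

Lemma primary_content (v : nat -> 'I_n) M : primary_ideal (content (fpoly (pvar R v) M)).
Proof.
have HI := is_ideal_content (fpoly (pvar R v) M).
have ker u : kill R (vars v M) u = 0 -> content (fpoly (pvar R v) M) u.
  apply: kill_eq0_ideal => // k /varsP[i iM <-].
  exact: content_fpoly_var.
apply: (@primary_torsion_free S _ (kill R (vars v M)) HI).
- by move=> u; apply: content_kill.
- by move=> u; apply: kill_kill.
- by move=> u /ker Hu; exists 1%N; rewrite expr1.
- move=> c u c0 /(content_kill (fun _ => id)) /eqP.
  rewrite rmorphM kill_kill // mulf_eq0 (negbTE c0) /= => /eqP u0.
  exact: ker.
Qed.

Lemma primary_L2 (vx vy : nat -> 'I_n) M N : (0 < M)%N -> (0 < N)%N ->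
  inj_lt vx M -> inj_lt vy N -> disj_lt vx M vy N ->
  primary_ideal (L2 (pvar R vx) M (pvar R vy) N).
Proof.
move=> M0 N0 injx injy disj; have HL := is_ideal_L2 (pvar R vx) M (pvar R vy) N.
have HK := is_ideal_kill (vxy vx vy M N).
have sX : subpred (vars vx M) (vxy vx vy M N) by move=> k; rewrite /vxy /= => ->.
have sY : subpred (vars vy N) (vxy vx vy M N).
  by move=> k; rewrite /vxy /= => ->; rewrite orbT.
apply: (@primary_torsion_free S _ (kill R (vxy vx vy M N)) HL).
- apply: (L2_min HK) => u.
  + by move=> /content_mull; apply: content_kill.
  + exact: pow_content_kill.
  + exact: pow_content_kill.
- by move=> u; apply: kill_kill.
- move=> u; apply: (kill_eq0_ideal (is_ideal_radical HL)) => k /orP[] /varsP[i iM <-] /=.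
  + by exists N; apply: L2_f; apply: ideal_powX; apply: content_fpoly_var.
  + by exists M; apply: L2_g; apply: ideal_powX; apply: content_fpoly_var.
- by move=> c u; apply: L2_torsion_free.
Qed.

Lemma killT u : exists r : R, kill R (predT : pred 'I_n) u = r%:MP.
Proof.
exists (u@_0%MM); have := @eq_mpoly_morph R n _ (kill R (predT : pred 'I_n))
  (@mpolyC n R \o mcoeff 0%MM : {rmorphism S -> S}).
apply=> [c|i] /=; first by rewrite substC mpolyCK.
by rewrite substX mcoeffX mnm1_eq0.
Qed.

End KillIdeal.

(** * Primality of L(f, g, h) up to powers, and the intersection *)

Section Triple.
Variables (R : idomainType) (n : nat).
Local Notation S := {mpoly R[n]}.
Implicit Types vx vy vz : nat -> 'I_n.
Local Notation L2' vx M vy N := (L2 (pvar R vx) M (pvar R vy) N).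
Local Notation L3' vx M vy N vz P := (L3 (pvar R vx) M (pvar R vy) N (pvar R vz) P).
Local Notation fp v M := (fpoly (pvar R v) M).

Lemma graded_L2 V vx M vy N d1 d2 : (forall k, homdeg V d1 (fp vx M)`_k) ->
  (forall k, homdeg V d2 (fp vy N)`_k) -> graded V (L2' vx M vy N).
Proof.
move=> H1 H2; do ?apply: graded_add; try apply: graded_pow.
- exact: (graded_content (homdeg_coefM H1 H2)).
- exact: (graded_content H1).
- exact: (graded_content H2).
Qed.

Lemma graded_L3 V vx M vy N vz P d1 d2 d3 :
  (forall k, homdeg V d1 (fp vx M)`_k) -> (forall k, homdeg V d2 (fp vy N)`_k) ->
  (forall k, homdeg V d3 (fp vz P)`_k) -> graded V (L3' vx M vy N vz P).
Proof.
move=> H1 H2 H3.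
do ?apply: graded_add; try apply: graded_pow.
- exact: (graded_content (homdeg_coefM (homdeg_coefM H1 H2) H3)).
- exact: (graded_content (homdeg_coefM H1 H2)).
- exact: (graded_content (homdeg_coefM H1 H3)).
- exact: (graded_content (homdeg_coefM H2 H3)).
- exact: (graded_content H1).
- exact: (graded_content H2).
- exact: (graded_content H3).
Qed.

Section Degrees.
Variables (vx vy vz : nat -> 'I_n) (M N P : nat).
Hypothesis tri : triple vx M vy N vz P.
Local Notation X := (vars vx M).
Local Notation Y := (vars vy N).
Local Notation Z := (vars vz P).
Local Notation f := (fp vx M).
Local Notation g := (fp vy N).
Local Notation h := (fp vz P).

Lemma tri_degX : [/\ forall k, homdeg X 1 f`_k, forall k, homdeg X 0 g`_k &
  forall k, homdeg X 0 h`_k].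
Proof.
split=> k; [exact: homdeg_fpoly|exact: (homdeg_fpoly_disj (tri_xy tri))|].
exact: (homdeg_fpoly_disj (tri_xz tri)).
Qed.

Lemma tri_degY : [/\ forall k, homdeg Y 0 f`_k, forall k, homdeg Y 1 g`_k &
  forall k, homdeg Y 0 h`_k].
Proof.
split=> k; [|exact: homdeg_fpoly|exact: (homdeg_fpoly_disj (tri_yz tri))].
exact: (homdeg_fpoly_disj (disj_ltC (tri_xy tri))).
Qed.

Lemma tri_degZ : [/\ forall k, homdeg Z 0 f`_k, forall k, homdeg Z 0 g`_k &
  forall k, homdeg Z 1 h`_k].
Proof.
split=> k; last exact: homdeg_fpoly.
  exact: (homdeg_fpoly_disj (disj_ltC (tri_xz tri))).
exact: (homdeg_fpoly_disj (disj_ltC (tri_yz tri))).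
Qed.

Lemma proj3C a b c (u : S) : proj X a (proj Y b (proj Z c u)) =
  proj X a (proj Z c (proj Y b u)) /\
  proj X a (proj Y b (proj Z c u)) = proj Y b (proj Z c (proj X a u)) /\
  proj X a (proj Y b (proj Z c u)) = proj Z c (proj X a (proj Y b u)).
Proof.
split; first by rewrite (projC Y Z).
split; first by rewrite projC; congr (proj _ _ _); rewrite projC.
by rewrite [proj Z c (proj X a _)]projC (projC Y Z).
Qed.

Lemma bih_proj3 a b c (u : S) v :
  v = proj X a (proj Y b (proj Z c u)) ->
  bihS (pvar R vx) (pvar R vy) M N (kill R (vxy vx vy M N)) 0 0 a b v.
Proof. by move=> ->; apply: (bih_proj (tri_xy tri)). Qed.

End Degrees.

Lemma L2_low vx M vy N a b u : disj_lt vx M vy N -> (a < N)%N -> (b < M)%N ->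
  L2' vx M vy N u ->
  content (fp vx M * fp vy N) (proj (vars vx M) a (proj (vars vy N) b u)).
Proof.
move=> disj aN bM; have Xf := @homdeg_fpoly R n vx M; have Yg := @homdeg_fpoly R n vy N.
have Yf k := @homdeg_fpoly_disj R n vy vx N M k (disj_ltC disj).
have Xg k := @homdeg_fpoly_disj R n vx vy M N k disj.
case=> _ [s1 Hs1 [s2 Hs2 <-]] [s3 Hs3 <-]; rewrite !projD.
rewrite (projC _ _ _ _ s2) (proj_pow_low Xf Hs2) ?mul1n // proj0 addr0.
rewrite (proj_pow_low Yg Hs3) ?mul1n // proj0 addr0.
apply: (graded_content (homdeg_coefM Xf Xg)).
exact: (graded_content (homdeg_coefM Yf Yg)).
Qed.

Lemma L3_torsion_free vx M vy N vz P (r : R) u : triple vx M vy N vz P -> r != 0 ->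
  L3' vx M vy N vz P (r%:MP * u) -> L3' vx M vy N vz P u.
Proof.
move=> tri r0 Lru; have [M0 N0 P0] := tri_pos tri.
have HL := is_ideal_L3 (pvar R vx) M (pvar R vy) N (pvar R vz) P.
case: (HL) => L0 LD _; have tri' := triple_swap tri; have tri'' := triple_rot tri.
apply: (proj_ind (V := vars vz P)) => // c; apply: (proj_ind (V := vars vy N)) => // b.
apply: (proj_ind (V := vars vx M)) => // a.
have Lproj V d : graded V (L3' vx M vy N vz P) ->
    L3' vx M vy N vz P (r%:MP * proj V d u).
  by move=> gV; rewrite -projM0; [apply: gV|exact: homdegC].
have [X1 X2 X3] := tri_degX tri; have [Y1 Y2 Y3] := tri_degY tri.
have [Z1 Z2 Z3] := tri_degZ tri.
have [ba|ab] := ltnP b (a + M)%N; first (have [ab|ba'] := ltnP a (b + N)%N).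
  apply: (L3_torsion_free_range tri r0 ba ab); apply: Lproj; exact: graded_L3.
all: have [ca|ac] := ltnP c (a + M)%N; first (have [ac|ca'] := ltnP a (c + P)%N).
all: try by have [-> _] := proj3C vx vy vz M N P a b c u; apply: L3_swap;
  apply: (L3_torsion_free_range tri' r0 ca ac); apply: L3_swap; apply: Lproj;
  exact: graded_L3.
all: have [cb|bc] := ltnP c (b + N)%N; first (have [bc|cb'] := ltnP b (c + P)%N).
all: try by have [_ [-> _]] := proj3C vx vy vz M N P a b c u; do 2!apply: L3_rot;
  apply: (L3_torsion_free_range tri'' r0 cb bc); apply: L3_rot; apply: Lproj;
  exact: graded_L3.
all: have Hx := bih_proj3 tri (erefl (proj (vars vx M) a (proj (vars vy N) b (proj (vars vz P) c u)))).
all: have [_ [E _]] := proj3C vx vy vz M N P a b c u.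
all: have Hy := bih_proj3 tri'' E.
all: have [Hf Hg] := bih_pow Hx; have [_ Hh] := bih_pow Hy.
(* Outside all three ranges the gaps add up: for instance a >= b + N and b >= c + P give a >= N + P.
   The largest of the three degrees thus reaches its exponent. *)
all: have [aH|aL] := leqP (N + P).-1 a; first by apply: L3_f; apply: ideal_pow_le Hf.
all: have [bH|bL] := leqP (M + P).-1 b; first by apply: L3_g; apply: ideal_pow_le Hg.
all: have [cH|cL] := leqP (M + N).-1 c; first by apply: L3_h; apply: ideal_pow_le Hh.
all: lia.
Qed.

Lemma primary_L3 vx M vy N vz P : triple vx M vy N vz P ->
  primary_ideal (L3' vx M vy N vz P).
Proof.
move=> tri; have [M0 N0 P0] := tri_pos tri.
have HL := is_ideal_L3 (pvar R vx) M (pvar R vy) N (pvar R vz) P.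
have HK := is_ideal_kill R (predT : pred 'I_n).
apply: (@primary_torsion_free S _ (kill R (predT : pred 'I_n)) HL).
- apply: (L3_min HK) => u.
  + by move=> /content_mull/content_mull; apply: content_kill.
  + by move=> /(ideal_pow_mono (@content_mull _ _ _)); apply: pow_content_kill.
  + by move=> /(ideal_pow_mono (@content_mull _ _ _)); apply: pow_content_kill.
  + by move=> /(ideal_pow_mono (@content_mull _ _ _)); apply: pow_content_kill.
  + by apply: pow_content_kill => //; lia.
  + by apply: pow_content_kill => //; lia.
  + by apply: pow_content_kill => //; lia.
- by move=> u; apply: kill_kill.
- move=> u; apply: (kill_eq0_ideal (is_ideal_radical HL)) => k _ /=.
  have /or3P[] := tri_cover tri k => /varsP[i iM <-].
  + by eexists; apply: L3_f; apply: ideal_powX; apply: content_fpoly_var.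
  + by eexists; apply: L3_g; apply: ideal_powX; apply: content_fpoly_var.
  + by eexists; apply: L3_h; apply: ideal_powX; apply: content_fpoly_var.
- move=> c u; have [r ->] := killT c; rewrite mpolyC_eq0 => r0.
  exact: L3_torsion_free.
Qed.

(** First [v] lies in c(g h): by Dedekind-Mertens if b >= P or c >= N, and otherwise because only
    c(g h) contributes to L(g, h) in such bidegrees. Then the x-degree reaches the number N + P - 1
    of coefficients of [g h]. *)
Lemma content_fgh_high vx M vy N vz P a b c (u v : S) : triple vx M vy N vz P ->
  v = proj (vars vx M) a (proj (vars vy N) b (proj (vars vz P) c u)) ->
  ((N + P).-1 <= a)%N -> (0 < b)%N -> (0 < c)%N ->
  L2' vy N vz P v -> content (fp vx M * fp vy N * fp vz P) v.
Proof.
move=> tri vE aH b0 c0 L2v; have tri' := triple_rot tri.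
have [_ [E2 _]] := proj3C vx vy vz M N P a b c u.
have Hv := bih_proj3 tri' (etrans vE E2).
set e0 := kill R _ in Hv.
have DM := Dedekind_Mertens (range1 e0) (@rangeM _ _ e0) (@rangeN _ _ e0).
have [X1 X2 X3] := tri_degX tri; have [Y1 Y2 Y3] := tri_degY tri.
have [Z1 Z2 Z3] := tri_degZ tri.
have : content (fp vy N * fp vz P) v.
  case: b c b0 c0 vE E2 Hv => [|b] [|c] // _ _ vE E2 Hv.
  have [Pb|bP] := leqP (P - 0) b.+1.
    exact: pspan_content (DM _ _ _ _ _ _ _ _ _ Pb Hv).
  have [Nc|cN] := leqP (N - 0) c.+1.
    rewrite mulrC; exact: pspan_content (DM _ _ _ _ _ _ _ _ _ Nc (bih_swap Hv)).
  have vY : proj (vars vy N) b.+1 v = v by rewrite vE E2 proj_id.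
  have vZ : proj (vars vz P) c.+1 v = v.
    have [_ [_ E3]] := proj3C vx vy vz M N P a b.+1 c.+1 u.
    by rewrite vE E3 proj_id.
  rewrite -vY -vZ; apply: L2_low => //; [exact: tri_yz tri|lia|lia].
rewrite fpolyM => Hgh; rewrite -mulrA fpolyM.
have := content_cross_high _ _ Hgh aH (v := vx) (M := M) (V := vars vx M).
rewrite {1}vE proj_id -vE; apply=> // k.
by rewrite -fpolyM; apply: (homdeg_coefM X2 X3).
Qed.

(** The upper bounds remove the three pure powers. Each power of a product of two polynomials has
    positive degree in the third family, so [content_cross] applies. *)
Lemma content_fgh_low vx M vy N vz P a b c (u : S) : triple vx M vy N vz P ->
  (a < (N + P).-1)%N -> (b < (M + P).-1)%N -> (c < (M + N).-1)%N ->
  (0 < a)%N -> (0 < b)%N -> (0 < c)%N -> L3' vx M vy N vz P u ->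
  content (fp vx M * fp vy N * fp vz P)
    (proj (vars vx M) a (proj (vars vy N) b (proj (vars vz P) c u))).
Proof.
move=> tri aL bL cL a0 b0 c0.
have [X1 X2 X3] := tri_degX tri; have [Y1 Y2 Y3] := tri_degY tri.
have [Z1 Z2 Z3] := tri_degZ tri.
set f := fp vx M in X1 Y1 Z1 *; set g := fp vy N in X2 Y2 Z2 *.
set h := fp vz P in X3 Y3 Z3 *.
have gX := graded_content (homdeg_coefM (homdeg_coefM X1 X2) X3).
have gY := graded_content (homdeg_coefM (homdeg_coefM Y1 Y2) Y3).
have gZ := graded_content (homdeg_coefM (homdeg_coefM Z1 Z2) Z3).
have [_ ED _] : is_ideal (content (f * g * h)) by exact: is_ideal_content.
case=> _ [_ [_ [_ [_ [s1 Hs1 [s2 Hs2 <-]] [s3 Hs3 <-]] [s4 Hs4 <-]]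
  [s5 Hs5 <-]] [s6 Hs6 <-]] [s7 Hs7 <-].
rewrite !projD.
rewrite (proj_pow_low Z3 Hs7) ?mul1n // !proj0 addr0.
have [_ [-> _]] := proj3C vx vy vz M N P a b c s5.
rewrite (proj_pow_low X1 Hs5) ?mul1n // !proj0 addr0.
have [_ [_ ->]] := proj3C vx vy vz M N P a b c s6.
rewrite (proj_pow_low Y2 Hs6) ?mul1n // !proj0 addr0.
do ?apply: (ED).
- by apply: gX; apply: gY; apply: gZ.
- apply: gX; apply: gY; move: Hs2 (homdeg_coefM Z1 Z2); rewrite fpolyM => Hs2 Zfg.
  exact: (content_cross Zfg).
- have [-> _] := proj3C vx vy vz M N P a b c s3.
  apply: gX; apply: gZ; move: Hs3 (homdeg_coefM Y1 Y3).
  rewrite mulrAC fpolyM => Hs3 Yfh.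
  exact: (content_cross Yfh).
- have [_ [-> _]] := proj3C vx vy vz M N P a b c s4.
  apply: gY; apply: gZ; move: Hs4 (homdeg_coefM X2 X3).
  rewrite -mulrA [f * _]mulrC fpolyM => Hs4 Xgh.
  exact: (content_cross Xgh).
Qed.

(** Each component uses different ideals: c(f), c(g), c(h) rule out a degree 0, a large degree in
    one family calls for the ideal L of the other two polynomials, and the rest is left to L(f, g,
    h). *)
Lemma content_fgh_inter vx M vy N vz P (u : S) : triple vx M vy N vz P ->
  content (fp vx M) u -> content (fp vy N) u -> content (fp vz P) u ->
  L2' vx M vy N u -> L2' vx M vz P u -> L2' vy N vz P u ->
  L3' vx M vy N vz P u -> content (fp vx M * fp vy N * fp vz P) u.
Proof.
move=> tri Cf Cg Ch Lfg Lfh Lgh Lfgh.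
have [X1 X2 X3] := tri_degX tri; have [Y1 Y2 Y3] := tri_degY tri.
have [Z1 Z2 Z3] := tri_degZ tri; have tri' := triple_rot tri; have tri'' := triple_rot tri'.
have HC := is_ideal_content (fp vx M * fp vy N * fp vz P).
case: (HC) => C0 CD _.
apply: (proj_ind (V := vars vz P)) => // c; apply: (proj_ind (V := vars vy N)) => // b.
apply: (proj_ind (V := vars vx M)) => // a.
set v := proj _ a _; have vE : v = proj (vars vx M) a (proj (vars vy N) b (proj (vars vz P) c u)) by [].
have [_ [E2 E3]] := proj3C vx vy vz M N P a b c u.
have [a0|a0] := posnP a.
  by rewrite vE E2 (proj_content_low X1 Cf) ?a0 // !proj0.
have [b0|b0] := posnP b.
  by rewrite vE E3 (proj_content_low Y2 Cg) ?b0 // !proj0.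
have [c0|c0] := posnP c.
  by rewrite vE (proj_content_low Z3 Ch) ?c0 // !proj0.
have [aL|aH] := ltnP a (N + P).-1; last first.
  apply: (content_fgh_high tri vE) => //; rewrite vE.
  by apply: (graded_L2 X2 X3); apply: (graded_L2 Y2 Y3); apply: (graded_L2 Z2 Z3).
have [bL|bH] := ltnP b (M + P).-1; last first.
  rewrite -mulrA mulrC; apply: (content_fgh_high tri' (etrans vE E2)) => //.
    by rewrite addnC.
  rewrite vE; apply: L2_swap.
  by apply: (graded_L2 X1 X3); apply: (graded_L2 Y1 Y3); apply: (graded_L2 Z1 Z3).
have [cL|cH] := ltnP c (M + N).-1; last first.
  rewrite mulrC mulrA; apply: (content_fgh_high tri'' (etrans vE E3)) => //.
  rewrite vE.
  by apply: (graded_L2 X1 X2); apply: (graded_L2 Y1 Y2); apply: (graded_L2 Z1 Z2).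
exact: content_fgh_low.
Qed.

End Triple.

Theorem theorem7 (R : idomainType) (m n p : nat) :
  noetherian R ->
  let S := {mpoly R[m.+1 + n.+1 + p.+1]} in
  let x (i : 'I_m.+1) : S := 'X_(lshift p.+1 (lshift n.+1 i)) in
  let y (j : 'I_n.+1) : S := 'X_(lshift p.+1 (rshift m.+1 j)) in
  let z (k : 'I_p.+1) : S := 'X_(rshift (m.+1 + n.+1) k) in
  let f : {poly S} := \sum_(i < m.+1) x i *: 'X^i in
  let g : {poly S} := \sum_(j < n.+1) y j *: 'X^j in
  let h : {poly S} := \sum_(k < p.+1) z k *: 'X^k in
  let Lfg := (content (f * g) + content f ^ (n + 1) + content g ^ (m + 1))%ID in
  let Lfh := (content (f * h) + content f ^ (p + 1) + content h ^ (m + 1))%ID in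
  let Lgh := (content (g * h) + content g ^ (p + 1) + content h ^ (n + 1))%ID in
  let Lfgh := (content (f * g * h)
               + content (f * g) ^ (p + 1)
               + content (f * h) ^ (n + 1)
               + content (g * h) ^ (m + 1)
               + content f ^ (n + p + 1)
               + content g ^ (m + p + 1)
               + content h ^ (m + n + 1))%ID in
  primary_decomposition (content (f * g * h))
    [:: content f; content g; content h; Lfg; Lfh; Lgh; Lfgh].
Proof.
move=> _ S x y z f g h Lfg Lfh Lgh Lfgh.
(* [inord] extends the families to all of nat by a default value; only indices below the respective
   bound are ever used. *)
pose vx i : 'I_(m.+1 + n.+1 + p.+1) := lshift p.+1 (lshift n.+1 (inord i)).
pose vy j : 'I_(m.+1 + n.+1 + p.+1) := lshift p.+1 (rshift m.+1 (inord j)).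
pose vz k : 'I_(m.+1 + n.+1 + p.+1) := rshift (m.+1 + n.+1) (inord k).
have fE : f = fpoly (pvar R vx) m.+1.
  by apply: eq_bigr => i _; rewrite /pvar /vx inord_val.
have gE : g = fpoly (pvar R vy) n.+1.
  by apply: eq_bigr => i _; rewrite /pvar /vy inord_val.
have hE : h = fpoly (pvar R vz) p.+1.
  by apply: eq_bigr => i _; rewrite /pvar /vz inord_val.
have tri : triple vx m.+1 vy n.+1 vz p.+1.
  split=> //.
  - by move=> i j im jm /(congr1 val) /=; rewrite !inordK.
  - by move=> i j im jm /(congr1 val) /=; rewrite !inordK // => /addnI.
  - by move=> i j im jm /(congr1 val) /=; rewrite !inordK // => /addnI.
  - by move=> i j im jm /(congr1 val) /=; rewrite !inordK //; lia.
  - by move=> i j im jm /(congr1 val) /=; rewrite !inordK //; lia.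
  - by move=> i j im jm /(congr1 val) /=; rewrite !inordK //; lia.
  - move=> k; case: (split_ordP k) => [k1 ->|k1 ->]; last first.
      apply/or3P/Or33/varsP; exists k1 => //; by rewrite /vz inord_val.
    case: (split_ordP k1) => [k2 ->|k2 ->].
      by apply/or3P/Or31/varsP; exists k2 => //; rewrite /vx inord_val.
    by apply/or3P/Or32/varsP; exists k2 => //; rewrite /vy inord_val.
have LfgE : Lfg = L2 (pvar R vx) m.+1 (pvar R vy) n.+1.
  by rewrite /Lfg /L2 fE gE !addn1.
have LfhE : Lfh = L2 (pvar R vx) m.+1 (pvar R vz) p.+1.
  by rewrite /Lfh /L2 fE hE !addn1.
have LghE : Lgh = L2 (pvar R vy) n.+1 (pvar R vz) p.+1.
  by rewrite /Lgh /L2 gE hE !addn1.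
have LfghE : Lfgh = L3 (pvar R vx) m.+1 (pvar R vy) n.+1 (pvar R vz) p.+1.
  have eE i j : (i + j + 1 = (i.+1 + j.+1).-1)%N by lia.
  by rewrite /Lfgh /L3 !eE fE gE hE !addn1.
have [ijx ijy ijz dxy dxz dyz _ _] := tri.
split.
  move=> Q; rewrite !in_cons in_nil orbF.
  case/orP => [/eqP ->|]; first by rewrite fE; apply: primary_content.
  case/orP => [/eqP ->|]; first by rewrite gE; apply: primary_content.
  case/orP => [/eqP ->|]; first by rewrite hE; apply: primary_content.
  case/orP => [/eqP ->|]; first by rewrite LfgE; apply: primary_L2.
  case/orP => [/eqP ->|]; first by rewrite LfhE; apply: primary_L2.
  case/orP => [/eqP ->|/eqP ->]; first by rewrite LghE; apply: primary_L2.
  by rewrite LfghE; apply: primary_L3.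
rewrite !big_cons big_nil setIT LfgE LfhE LghE LfghE fE gE hE.
rewrite eqEsubset; split=> u.
  move=> Hu; have Hfg := content_mull Hu.
  have Hfh : content (fpoly (pvar R vx) m.+1 * fpoly (pvar R vz) p.+1) u.
    by move: Hu; rewrite mulrAC => /content_mull.
  have Hgh : content (fpoly (pvar R vy) n.+1 * fpoly (pvar R vz) p.+1) u.
    by move: Hu; rewrite -mulrA => /content_mulr.
  split; first exact: content_mull Hfg.
  split; first exact: content_mulr Hfg.
  split; first exact: content_mulr Hgh.
  split; first exact: L2_fg.
  split; first exact: L2_fg.
  split; first exact: L2_fg.
  exact: L3_fgh.
by move=> [Cf [Cg [Ch [L1 [L2 [L3 L4]]]]]]; apply: content_fgh_inter.
Qed.
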